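(* For every $A>0$ there is a constant $c>0$ depending only on $A$, and for every $A,K>0$ a constant $C>0$ depending only on $A,K$ (none of them depending on $n,p,\mathbf X,\beta_{\rm true},\epsilon$ or the tuning parameters), such that the following holds. Suppose $\|\mathrm f_{S_0}-\mathbf f^0\|_2^2/n\le A\,\lambda_{\rm init}^2 s_0/\phi^2(6,S_0)$ and $\epsilon\in\mathcal T$. (i) If $\dfrac{\lambda_{\rm init}}{\phi^2(6,S_0,2s_0)}\le c\,\lambda_{\rm thres}$ and $\lambda_{\rm thres}\le K\,\dfrac{\lambda_{\rm init}}{\phi^2(6,S_0,2s_0)}$, then $$\|\mathbf X\hat b_{\rm thres}-\mathbf f^0\|_2^2/n\le C\,\frac{\Lambda_{\rm sparse}^2(s_0)}{\phi^4(6,S_0,2s_0)}\,\lambda_{\rm init}^2s_0,$$ $$\|\hat b_{\rm thres}-b^0\|_1\le C\,\frac{\Lambda_{\rm sparse}(s_0)}{\phi_{\rm sparse}(S_0,2s_0)\,\phi^2(6,S_0,2s_0)}\,\lambda_{\rm init}s_0,$$ $$\|\hat b_{\rm thres}-b^0\|_2\le C\,\frac{\Lambda_{\rm sparse}(s_0)}{\phi_{\rm sparse}(S_0,2s_0)\,\phi^2(6,S_0,2s_0)}\,\lambda_{\rm init}\sqrt{s_0},$$ $$|\hat S_{\rm thres}\setminus S_0|\le C\,s_0.$$ (ii) If $\dfrac{\Lambda_{\rm sparse}(s_0)}{\phi_{\min}^3(6,S_0,2s_0)}\lambda_{\rm init}\le c\,\lambda_{\rm adap}$ and $\lambda_{\rm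 adap}\le K\,\dfrac{\Lambda_{\rm sparse}(s_0)}{\phi_{\min}^3(6,S_0,2s_0)}\lambda_{\rm init}$, then $$\|\mathbf X\hat\beta_{\rm adap}-\mathbf f^0\|_2^2/n\le C\,\frac{\Lambda_{\rm sparse}^2(s_0)}{\phi_{\min}^4(6,S_0,2s_0)}\,\lambda_{\rm init}^2s_0,$$ $$\|\hat\beta_{\rm adap}-b^0\|_1\le C\,\frac{\Lambda_{\rm sparse}(s_0)}{\phi_{\min}^3(6,S_0,2s_0)}\,\lambda_{\rm init}s_0,$$ $$\|\hat\beta_{\rm adap}-b^0\|_2\le C\,\frac{\Lambda_{\rm sparse}(s_0)}{\phi_{\min}^2(6,S_0,3s_0)\,\phi_{\min}(6,S_0,2s_0)}\,\lambda_{\rm init}\sqrt{s_0},$$ $$|\hat S_{\rm adap}\setminus S_0|\le C\,\frac{\Lambda_{\rm sparse}^2(s_0)\,\phi_{\min}^2(6,S_0,2s_0)}{\phi^4(6,S_0,2s_0)}\,s_0.$$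
   Context: Setting. $n,p\in\mathbb N$ with $p\ge n$; $\mathbf X\in\mathbb R^{n\times p}$ is a fixed matrix with columns $\mathbf X_1,\dots,\mathbf X_p$; $\hat\Sigma:=\mathbf X^T\mathbf X/n$ is normalized so that $\hat\Sigma_{j,j}=1$ for all $j$. $\beta_{\rm true}\in\mathbb R^p$, $\mathbf f^0:=\mathbf X\beta_{\rm true}$, $S_{\rm true}:=\{j:\beta_{j,{\rm true}}\ne0\}$, $\epsilon\in\mathbb R^n$ is the noise, $\mathbf Y=\mathbf f^0+\epsilon$. For $\beta\in\mathbb R^p$ and $S\subset\{1,\dots,p\}$, $\beta_S$ is the vector with $(\beta_S)_j=\beta_j 1\{j\in S\}$, and $S^c$ is the complement. Generalized eigenvalues. $\Lambda_{\max}^2(S):=\max_{\|\beta_S\|_2=1}\beta_S^T\hat\Sigma\beta_S$, $\Lambda_{\min}^2(S):=\min_{\|\beta_S\|_2=1}\beta_S^T\hat\Sigma\beta_S$. For $\mathcal N\supset S$ and $L>0$, $$\mathcal R(L,S,\mathcal N):=\{\beta:\ \|\beta_{\mathcal N^c}\|_1\le L\sqrt{|\mathcal N|}\,\|\beta_{\mathcal N}\|_2,\ \max_{j\in\mathcal N^c}|\beta_j|\le\min_{j\in\mathcal N\setminus S}|\beta_j|\}$$ (a minimum over the empty set is $+\infty$). For $N\ge|S|$, $\phi^2(L,S,N):=\min\{\beta^T\hat\Sigma\beta/\|\beta_{\mathcal N}\|_2^2:\ \mathcal N\supset S,\ |\mathcal N|\le N,\ \beta\in\mathcal R(L,S,\mathcal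 N),\ \beta_{\mathcal N}\neq0\}$, $\phi(L,S):=\phi(L,S,|S|)$, and $\phi_{\min}^2(L,S,N):=\min_{\mathcal N\supset S,\,|\mathcal N|=N}\phi^2(L,\mathcal N)$. Sparse eigenvalues: $\Lambda_{\rm sparse}(N):=\max_{|\mathcal N|=N}\Lambda_{\max}(\mathcal N)$, $\phi_{\rm sparse}(S,N):=\min_{\mathcal N\supset S,\,|\mathcal N|=N}\Lambda_{\min}(\mathcal N)$ for $|S|\le N$. The quantities appearing are assumed well defined (in particular $s_0\ge1$, $2s_0\le p$, and $3s_0\le p$ where $3s_0$ appears), and those in denominators positive. Oracle. $\mathrm f_S=\mathbf X b^S:=\arg\min_{f=\mathbf X\beta_S}\|f-\mathbf f^0\|_2$ ($b^S$ supported on $S$). $S_0$ is a minimizer over $S\subset S_{\rm true}$ of $\|\mathrm f_S-\mathbf f^0\|_2^2/n+7\lambda_{\rm init}^2|S|/\phi^2(6,S)$ (second term $0$ for $S=\emptyset$, $+\infty$ if $S\neq\emptyset$ and $\phi(6,S)=0$). $b^0:=b^{S_0}$, $s_0:=|S_0|$. Noise event. $\mathcal T:=\{4\max_{1\le j\le p}|\epsilon^T\mathbf X_j/n|\le\lambda_{\rm init}\}$; ''$\epsilon\in\mathcal T$'' means this inequality holds. Estimators. $\lambda_{\rm init},\lambda_{\rm thres},\lambda_{\rm adap}>0$. $\hat\beta_{\rm init}\in\arg\min_\beta\{\|\mathbf Y-\mathbf X\beta\|_2^2/n+\lambda_{\rm init}\|\beta\|_1\}$; $\hat S_{\rm thres}:=\{j:|\hat\beta_{j,{\rm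 init}}|>\lambda_{\rm thres}\}$; $\hat b_{\rm thres}$ minimizes $\|\mathbf Y-\mathbf X\beta\|_2^2/n$ over $\beta$ supported on $\hat S_{\rm thres}$. The adaptive Lasso is $\hat\beta_{\rm adap}\in\arg\min_\beta\{\|\mathbf Y-\mathbf X\beta\|_2^2/n+\lambda_{\rm init}\lambda_{\rm adap}\sum_{j=1}^p|\beta_j|/|\hat\beta_{j,{\rm init}}|\}$, where variables with $\hat\beta_{j,{\rm init}}=0$ are excluded (i.e. $\beta_j=0$ is imposed); $\hat S_{\rm adap}:=\{j:\hat\beta_{j,{\rm adap}}\ne0\}$. *)

(* Defs.v *)
From HB Require Import structures.
From mathcomp Require Import all_boot all_order all_algebra.
From mathcomp Require Import boolp classical_sets reals constructive_ereal.
Set Implicit Arguments.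
Unset Strict Implicit.
Unset Printing Implicit Defensive.
Import Order.TTheory GRing.Theory Num.Theory.
Local Open Scope classical_set_scope.
Local Open Scope ring_scope.

Definition is_argmin (R : realType) (T : Type) (D : set T) (F : T -> R) (x : T)
  : Prop := D x /\ forall y, D y -> F x <= F y.

(* The norm MathComp-Analysis puts on matrices is the sup norm, hence the
   explicit l1 and l2 norms. *)
Definition l1norm (R : realType) (m : nat) (v : 'cV[R]_m) : R :=
  \sum_(i < m) `|v i 0|.

Definition l2norm (R : realType) (m : nat) (v : 'cV[R]_m) : R :=
  Num.sqrt (\sum_(i < m) v i 0 ^+ 2).

(* beta_S *)
Definition restr (R : realType) (p : nat) (b : 'cV[R]_p) (S : {set 'I_p})
  : 'cV[R]_p := \col_j (if j \in S then b j 0 else 0).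

Definition supported (R : realType) (p : nat) (S : {set 'I_p})
  : set 'cV[R]_p := [set b | restr b S = b].

Section Design.
Variables (R : realType) (n p : nat) (X : 'M[R]_(n, p)).

Definition gram : 'M[R]_p := n%:R^-1 *: (X^T *m X).

Definition qform (b : 'cV[R]_p) : R := (b^T *m gram *m b) 0 0.

(* Below, maxima and minima are rendered by [sup] and [inf] in R. Over a
   nonempty feasible set they are attained: by compactness (after scaling, for
   [phi2]) or by finiteness. On an empty feasible set [sup] and [inf] are 0,
   a value that carries no meaning. *)

Definition Lambda_max2 (S : {set 'I_p}) : R :=
  sup [set qform (restr b S) | b in [set b | l2norm (restr b S) = 1]].
Definition Lambda_max (S : {set 'I_p}) : R := Num.sqrt (Lambda_max2 S).

Definition Lambda_min2 (S : {set 'I_p}) : R :=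
  inf [set qform (restr b S) | b in [set b | l2norm (restr b S) = 1]].
Definition Lambda_min (S : {set 'I_p}) : R := Num.sqrt (Lambda_min2 S).

(* The cone R(L, S, NN). The comparison of the maximum over the complement of
   NN with the minimum over NN \ S is stated pairwise, so that it is void when
   one of the two index sets is empty. *)
Definition cone (L : R) (S NN : {set 'I_p}) : set 'cV[R]_p :=
  [set b | l1norm (restr b (~: NN))
             <= L * Num.sqrt #|NN|%:R * l2norm (restr b NN)
        /\ forall j k : 'I_p, j \notin NN -> k \in NN :\: S ->
             `|b j 0| <= `|b k 0| ].

Definition phi2 (L : R) (S : {set 'I_p}) (N : nat) : R :=
  inf [set x | exists (NN : {set 'I_p}) (b : 'cV[R]_p),
         [/\ S \subset NN, (#|NN| <= N)%N, cone L S NN b, restr b NN != 0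
           & x = qform b / l2norm (restr b NN) ^+ 2] ].
Definition phi (L : R) (S : {set 'I_p}) (N : nat) : R := Num.sqrt (phi2 L S N).

(* phi(L, S) *)
Definition phi_card (L : R) (S : {set 'I_p}) : R := phi L S #|S|.

Definition phi_min2 (L : R) (S : {set 'I_p}) (N : nat) : R :=
  inf [set phi_card L NN ^+ 2
      | NN in [set NN : {set 'I_p} | S \subset NN /\ #|NN| = N] ].
Definition phi_min (L : R) (S : {set 'I_p}) (N : nat) : R :=
  Num.sqrt (phi_min2 L S N).

Definition Lambda_sparse (N : nat) : R :=
  sup [set Lambda_max NN | NN in [set NN : {set 'I_p} | #|NN| = N] ].

Definition phi_sparse (S : {set 'I_p}) (N : nat) : R :=
  inf [set Lambda_min NN
      | NN in [set NN : {set 'I_p} | S \subset NN /\ #|NN| = N] ].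

(* b minimizes the distance from X b to y among the vectors supported on S. *)
Definition least_squares (y : 'cV[R]_n) (S : {set 'I_p}) : 'cV[R]_p -> Prop :=
  is_argmin (supported S) (fun b => l2norm (X *m b - y)).

Definition oracle_penalty (lam : R) (S : {set 'I_p}) : \bar R :=
  if S == finset.set0 then 0%E
  else if phi_card 6 S == 0 then +oo%E
  else (7 * lam ^+ 2 * #|S|%:R / phi_card 6 S ^+ 2)%:E.

(* [b S] is the vector b^S, so that f_S = X b^S. *)
Definition oracle_crit (f0 : 'cV[R]_n) (b : {set 'I_p} -> 'cV[R]_p) (lam : R)
    (S : {set 'I_p}) : \bar R :=
  ((l2norm (X *m b S - f0) ^+ 2 / n%:R)%:E + oracle_penalty lam S)%E.

Definition is_oracle (f0 : 'cV[R]_n) (b : {set 'I_p} -> 'cV[R]_p) (lam : R)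
    (Strue S0 : {set 'I_p}) : Prop :=
  S0 \subset Strue /\
  forall S : {set 'I_p}, S \subset Strue ->
    (oracle_crit f0 b lam S0 <= oracle_crit f0 b lam S)%E.

Definition noise_event (lam : R) : set 'cV[R]_n :=
  [set eps |
    4 * \big[Num.max/0]_(j < p) `|(eps^T *m col j X) 0 0 / n%:R| <= lam].

Definition loss (Y : 'cV[R]_n) (b : 'cV[R]_p) : R :=
  l2norm (Y - X *m b) ^+ 2 / n%:R.

Definition is_lasso (Y : 'cV[R]_n) (lam : R) : 'cV[R]_p -> Prop :=
  is_argmin setT (fun b => loss Y b + lam * l1norm b).

Definition is_thres (Y : 'cV[R]_n) (S : {set 'I_p}) : 'cV[R]_p -> Prop :=
  is_argmin (supported S) (loss Y).

Definition is_adaptive_lasso (Y : 'cV[R]_n) (binit : 'cV[R]_p)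
    (lam lam_adap : R) : 'cV[R]_p -> Prop :=
  is_argmin [set b : 'cV[R]_p | forall j, binit j 0 = 0 -> b j 0 = 0]
    (fun b => loss Y b
       + lam * lam_adap * \sum_(j < p | binit j 0 != 0) `|b j 0| / `|binit j 0|).

End Design.

Definition active_set (R : realType) (p : nat) (b : 'cV[R]_p) : {set 'I_p} :=
  [set j | b j 0 != 0]%SET.

Definition thres_set (R : realType) (p : nat) (b : 'cV[R]_p) (lam : R)
  : {set 'I_p} := [set j | lam < `|b j 0|]%SET.

(* Main.v *)
Require Import Defs.
From mathcomp Require Import all_boot all_order all_algebra.
From mathcomp Require Import boolp classical_sets reals constructive_ereal.
From mathcomp Require Import ring lra.
Import Order.TTheory GRing.Theory Num.Theory.
Local Open Scope ring_scope.

(** Write s = |S0|, kappa = phi(6, S0, 2s), Lam = Lambda_sparse(s) and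
    theta = lambda_init sqrt(s) / kappa^2; then kappa <= 1 <= Lam.

    - Exchanging the coordinates of N \ S for the largest ones outside S shows
      phi_min(L, S, N) = phi(L, S, N), so that kappa governs both estimators.
    - The basic inequality gives ||binit - b0||_2 <= D theta with D depending
      only on A. Hence at most s coordinates outside S0 exceed a threshold
      tau >= D theta / sqrt(s), and the oracle b0 truncated to the coordinates
      where |binit| > tau has prediction error O(Lam (theta + tau sqrt(s))).
    - Both estimators are compared with this truncated oracle. For the adaptive
      Lasso the right threshold is tau = D lambda_init / kappa^2, not
      lambda_adap: the weighted penalty then acts like an l1 penalty of level
      lambda_init lambda_adap / tau >= lambda_init, which restricts the error to
      the cone of constant 6 around a set of size 2s.
    - The stationarity condition bounds the number of false positives: among
      those with |binit| <= tau one keeps the s with the smallest |binit|, so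
      that only Lambda_sparse(s) enters. *)

(** * Norms and coordinate subsets *)

Section Subsets.
Set Implicit Arguments.
Unset Strict Implicit.

(** Induction on [k]: the next element adjoined is a maximizer of [f] over [A :\: B]. *)
Lemma ex_top_subset d (O : orderType d) (T : finType) (f : T -> O)
    (A : {set T}) (k : nat) :
  (k <= #|A|)%N ->
  exists B : {set T}, [/\ B \subset A, #|B| = k &
    forall i j, i \in A :\: B -> j \in B -> (f i <= f j)%O].
Proof.
elim: k => [_|k IH kA].
  by exists finset.set0; rewrite finset.sub0set cards0; split=> // i j _; rewrite inE.
have [B [BA Bk Btop]] := IH (ltnW kA).
have /finset.set0Pn[x0 x0AB] : A :\: B != finset.set0.
  by rewrite -card_gt0 cardsD (finset.setIidPr BA) Bk subn_gt0.
pose x := [arg max_(x > x0 in A :\: B) f x]%O.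
have [xAB xmax] : x \in A :\: B /\ forall i, i \in A :\: B -> (f i <= f x)%O.
  by rewrite /x; case: arg_maxP.
have /finset.setDP[xA xB] := xAB.
exists (x |: B); split; first by rewrite finset.subUset finset.sub1set xA.
- by rewrite cardsU1 xB Bk.
move=> i j /finset.setDP[iA]; rewrite !inE negb_or => /andP[_ iB] /orP[/eqP ->|jB].
  by apply: xmax; rewrite inE iB.
by apply: Btop; rewrite // inE iB.
Qed.

Lemma ex_superset (T : finType) (A : {set T}) (k : nat) :
  (#|A| <= k <= #|T|)%N -> exists2 B : {set T}, A \subset B & #|B| = k.
Proof.
case/andP => Ak kT.
(* A constant function, since only the cardinality matters here. *)
have [|B [BA Bk _]] := @ex_top_subset _ nat T (fun=> 0%N) (~: A) (k - #|A|).
  by rewrite [#|~: A|]cardsCs finset.setCK leq_sub2r.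
exists (A :|: B); first exact: finset.subsetUl.
rewrite cardsU Bk (_ : A :&: B = finset.set0) ?cards0 ?subn0 ?subnKC //.
apply/setP => i; rewrite !inE; apply/negbTE/andP => -[iA /(fintype.subsetP BA)].
by rewrite inE iA.
Qed.

End Subsets.

Section Norms.
Set Implicit Arguments.
Unset Strict Implicit.
Variable R : realType.

Definition dot m (u v : 'cV[R]_m) : R := \sum_(i < m) u i 0 * v i 0.

Lemma dotC m (u v : 'cV[R]_m) : dot u v = dot v u.
Proof. by apply: eq_bigr => i _; rewrite mulrC. Qed.

Lemma dotDr m (u v w : 'cV[R]_m) : dot u (v + w) = dot u v + dot u w.
Proof. by rewrite -big_split; apply: eq_bigr => i _; rewrite mxE mulrDr. Qed.

Lemma dotZr m (a : R) (u v : 'cV[R]_m) : dot u (a *: v) = a * dot u v.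
Proof. by rewrite mulr_sumr; apply: eq_bigr => i _; rewrite mxE mulrCA. Qed.

Lemma dotNr m (u v : 'cV[R]_m) : dot u (- v) = - dot u v.
Proof. by rewrite -scaleN1r dotZr mulN1r. Qed.

Lemma dot_mulmx n p (X : 'M[R]_(n, p)) u v :
  dot u (X *m v) = \sum_(j < p) v j 0 * dot u (col j X).
Proof.
under [RHS]eq_bigr => j _ do rewrite mulr_sumr.
rewrite exchange_big; apply: eq_bigr => i _; rewrite mxE mulr_sumr.
by apply: eq_bigr => j _; rewrite mxE; ring.
Qed.

Lemma l2norm_ge0 m (v : 'cV[R]_m) : 0 <= l2norm v.
Proof. exact: sqrtr_ge0. Qed.

Lemma l2norm_sqr m (v : 'cV[R]_m) : l2norm v ^+ 2 = \sum_(i < m) v i 0 ^+ 2.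
Proof. by rewrite sqr_sqrtr // sumr_ge0 // => i _; exact: sqr_ge0. Qed.

Lemma l2norm_dot m (v : 'cV[R]_m) : l2norm v ^+ 2 = dot v v.
Proof. by rewrite l2norm_sqr; apply: eq_bigr => i _; rewrite expr2. Qed.

Lemma l2norm0 m : l2norm (0 : 'cV[R]_m) = 0.
Proof.
by rewrite /l2norm big1 ?sqrtr0 // => i _; rewrite mxE expr0n.
Qed.

Lemma l2norm_eq0 m (v : 'cV[R]_m) : (l2norm v == 0) = (v == 0).
Proof.
apply/eqP/eqP => [v0|->]; last exact: l2norm0.
have := l2norm_sqr v; rewrite v0 expr0n /= => /esym/eqP.
rewrite psumr_eq0 => [/allP vi0|i _]; last exact: sqr_ge0.
apply/colP => i; rewrite mxE; apply/eqP; rewrite -sqrf_eq0.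
by apply: vi0; rewrite mem_index_enum.
Qed.

Lemma l2normZ m (a : R) (v : 'cV[R]_m) : l2norm (a *: v) = `|a| * l2norm v.
Proof.
apply/eqP; rewrite -(@eqrXn2 _ 2) ?mulr_ge0 ?l2norm_ge0 //.
rewrite exprMn real_normK ?num_real // !l2norm_dot dotZr dotC dotZr.
by apply/eqP; ring.
Qed.

Lemma l2normN m (v : 'cV[R]_m) : l2norm (- v) = l2norm v.
Proof. by rewrite -scaleN1r l2normZ normrN1 mul1r. Qed.

Lemma l2norm_sqrD m (u v : 'cV[R]_m) :
  l2norm (u + v) ^+ 2 = l2norm u ^+ 2 + 2 * dot u v + l2norm v ^+ 2.
Proof.
rewrite !l2norm_dot dotDr !(dotC (u + v)) !dotDr (dotC v u); ring.
Qed.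

Lemma cauchy_schwarz m (u v : 'cV[R]_m) : dot u v <= l2norm u * l2norm v.
Proof.
have [u0|u0] := eqVneq (l2norm u) 0.
  move/eqP: u0 (u0); rewrite l2norm_eq0 => /eqP -> ->.
  by rewrite mul0r dotC -[0 : 'cV_m](scale0r v) dotZr mul0r.
have [v0|v0] := eqVneq (l2norm v) 0.
  move/eqP: v0 (v0); rewrite l2norm_eq0 => /eqP -> ->.
  by rewrite mulr0 -[0 : 'cV_m](scale0r u) dotZr mul0r.
have uv0 : 0 < l2norm u * l2norm v.
  by rewrite mulr_gt0 // lt0r l2norm_ge0 ?u0 ?v0.
(* With [P = l2norm u * l2norm v], this square expands to [2 * P * (P - dot u v)]. *)
have := sqr_ge0 (l2norm (l2norm v *: u + (- l2norm u) *: v)).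
rewrite l2norm_sqrD !l2normZ dotZr dotC dotZr (dotC v) normrN.
rewrite !ger0_norm ?l2norm_ge0 // => h.
rewrite -(ler_pM2l uv0); lra.
Qed.

Lemma l2normD m (u v : 'cV[R]_m) : l2norm (u + v) <= l2norm u + l2norm v.
Proof.
rewrite -ler_sqr ?nnegrE ?addr_ge0 ?l2norm_ge0 // l2norm_sqrD sqrrD.
have := cauchy_schwarz u v; lra.
Qed.

Lemma l1norm_ge0 m (v : 'cV[R]_m) : 0 <= l1norm v.
Proof. by apply: sumr_ge0. Qed.

Lemma l1normD m (u v : 'cV[R]_m) : l1norm (u + v) <= l1norm u + l1norm v.
Proof.
by rewrite -big_split; apply: ler_sum => i _; rewrite mxE ler_normD.
Qed.

Lemma restrK m (v : 'cV[R]_m) (A B : {set 'I_m}) :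
  A \subset B -> restr (restr v A) B = restr v A.
Proof.
move/fintype.subsetP => AB; apply/colP => i; rewrite !mxE.
by case: ifP => // /negbT; case: ifP => // /AB ->.
Qed.

Lemma restrD m (u v : 'cV[R]_m) (A : {set 'I_m}) :
  restr (u + v) A = restr u A + restr v A.
Proof. by apply/colP => i; rewrite !mxE; case: ifP; rewrite ?addr0. Qed.

Lemma restrN m (v : 'cV[R]_m) (A : {set 'I_m}) : restr (- v) A = - restr v A.
Proof. by apply/colP => i; rewrite !mxE; case: ifP; rewrite ?oppr0. Qed.

Lemma restrZ m a (v : 'cV[R]_m) (A : {set 'I_m}) :
  restr (a *: v) A = a *: restr v A.
Proof. by apply/colP => i; rewrite !mxE; case: ifP; rewrite ?mulr0. Qed.

Lemma restr_splitE m (v : 'cV[R]_m) (A : {set 'I_m}) :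
  v = restr v A + restr v (~: A).
Proof.
by apply/colP => i; rewrite !mxE inE; case: (i \in A); rewrite ?addr0 ?add0r.
Qed.

Lemma l1norm_restrE m (v : 'cV[R]_m) (A : {set 'I_m}) :
  l1norm (restr v A) = \sum_(i in A) `|v i 0|.
Proof.
rewrite [RHS]big_mkcond; apply: eq_bigr => i _; rewrite mxE.
by case: ifP; rewrite ?normr0.
Qed.

Lemma l2norm_restrE m (v : 'cV[R]_m) (A : {set 'I_m}) :
  l2norm (restr v A) ^+ 2 = \sum_(i in A) v i 0 ^+ 2.
Proof.
rewrite l2norm_sqr [RHS]big_mkcond; apply: eq_bigr => i _; rewrite mxE.
by case: ifP; rewrite ?expr0n.
Qed.

Lemma l1norm_split m (v : 'cV[R]_m) (A : {set 'I_m}) :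
  l1norm v = l1norm (restr v A) + l1norm (restr v (~: A)).
Proof.
rewrite !l1norm_restrE [LHS](bigID (mem A)) /=; congr (_ + _).
by apply: eq_bigl => i; rewrite inE.
Qed.

Lemma l1norm_restr_le m (v : 'cV[R]_m) (A : {set 'I_m}) :
  l1norm (restr v A) <= l1norm v.
Proof. by rewrite (l1norm_split v A) lerDl l1norm_ge0. Qed.

Lemma l1norm_restrS m (v : 'cV[R]_m) (A B : {set 'I_m}) :
  A \subset B -> l1norm (restr v A) <= l1norm (restr v B).
Proof.
move=> AB; rewrite -(_ : restr (restr v B) A = restr v A) ?l1norm_restr_le //.
apply/colP => i; rewrite !mxE.
by case: ifP => // /(fintype.subsetP AB) ->.
Qed.

Lemma l2norm_restrS m (v : 'cV[R]_m) (A B : {set 'I_m}) :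
  A \subset B -> l2norm (restr v A) <= l2norm (restr v B).
Proof.
move=> /fintype.subsetP AB; rewrite -ler_sqr ?nnegrE ?l2norm_ge0 // !l2norm_restrE.
rewrite [leLHS]big_mkcond [leRHS]big_mkcond.
apply: ler_sum => i _; case: ifP => [/AB -> //|_].
by case: ifP => // _; apply: sqr_ge0.
Qed.

Lemma l2norm_restr_le m (v : 'cV[R]_m) (A : {set 'I_m}) :
  l2norm (restr v A) <= l2norm v.
Proof.
rewrite -ler_sqr ?nnegrE ?l2norm_ge0 // l2norm_restrE l2norm_sqr big_mkcond.
by apply: ler_sum => i _; case: ifP => // _; apply: sqr_ge0.
Qed.

Lemma sum_sqr_le_l2norm m (v : 'cV[R]_m) (A : {set 'I_m}) :
  \sum_(i in A) v i 0 ^+ 2 <= l2norm v ^+ 2.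
Proof.
by rewrite -l2norm_restrE ler_sqr ?nnegrE ?l2norm_ge0 // l2norm_restr_le.
Qed.

(** Cauchy-Schwarz for the indicator of [A] and the absolute values of the entries. *)
Lemma l1norm_le_l2norm m (v : 'cV[R]_m) (A : {set 'I_m}) :
  l1norm (restr v A) <= Num.sqrt #|A|%:R * l2norm (restr v A).
Proof.
pose one : 'cV[R]_m := \col_i (i \in A)%:R.
pose a : 'cV[R]_m := \col_i `|restr v A i 0|.
have -> : l1norm (restr v A) = dot one a.
  by apply: eq_bigr => i _; rewrite !mxE; case: ifP; rewrite ?mul1r ?normr0 ?mulr0.
apply: le_trans (cauchy_schwarz _ _) _; rewrite le_eqVlt; apply/predU1P; left.
congr (_ * _); rewrite /l2norm; last first.
  by congr Num.sqrt; apply: eq_bigr => i _; rewrite mxE real_normK ?num_real.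
congr Num.sqrt; rewrite -sum1_card natr_sum [RHS]big_mkcond.
by apply: eq_bigr => i _; rewrite mxE; case: ifP; rewrite ?expr1n ?expr0n.
Qed.

Lemma card_le_of_l2norm m (v : 'cV[R]_m) (A : {set 'I_m}) (a : R) :
  0 <= a -> (forall j, j \in A -> a <= `|v j 0|) ->
  #|A|%:R * a ^+ 2 <= l2norm v ^+ 2.
Proof.
move=> a0 av; apply: le_trans (sum_sqr_le_l2norm v A).
rewrite mulr_natl -sumr_const; apply: ler_sum => j /av.
by move=> h; rewrite -(real_normK (num_real (v j 0))) ler_sqr ?nnegrE.
Qed.

(** Every value kept is at most every value discarded, so the average over [B] is at most the
    average over [A]; cross-multiplying avoids a division by [#|A|]. *)
Lemma ex_bottom_subset (T : finType) (f : T -> R) (A : {set T}) (k : nat) :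
  (k <= #|A|)%N ->
  exists B : {set T}, [/\ B \subset A, #|B| = k &
    #|A|%:R * (\sum_(j in B) f j) <= k%:R * (\sum_(j in A) f j)].
Proof.
move=> kA; have [B [BA Bk Bbot]] := @ex_top_subset _ R T (fun x => - f x) A k kA.
exists B; split=> //.
have -> : \sum_(j in A) f j = \sum_(j in B) f j + \sum_(j in A :\: B) f j.
  rewrite (big_setID B) /=; congr (_ + _).
  by apply: eq_bigl => i; rewrite (finset.setIidPr BA).
have -> : #|A|%:R = k%:R + #|A :\: B|%:R :> R.
  by rewrite -natrD cardsD (finset.setIidPr BA) Bk subnKC.
rewrite mulrDl mulrDr lerD2l.
rewrite -Bk !mulr_natl -!sumr_const.
rewrite exchange_big /=; apply: ler_sum => j jB; apply: ler_sum => i iAB.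
by rewrite -lerN2; apply: Bbot.
Qed.

End Norms.

(** * Restricted and sparse eigenvalues *)

Section Design.
Set Implicit Arguments.
Unset Strict Implicit.
Variables (R : realType) (n p : nat) (X : 'M[R]_(n, p)).
Implicit Types (u : 'cV[R]_n) (b v : 'cV[R]_p) (S N : {set 'I_p}).

(** The empirical norm, scaled so that [qform X b = enorm (X *m b) ^+ 2]; eigenvalue bounds become
    linear in it. *)
Definition enorm u : R := l2norm u / Num.sqrt n%:R.

Lemma enorm_sqr u : enorm u ^+ 2 = l2norm u ^+ 2 / n%:R.
Proof. by rewrite expr_div_n (sqr_sqrtr (ler0n _ _)). Qed.

Lemma enorm_ge0 u : 0 <= enorm u.
Proof. by apply: divr_ge0; rewrite ?l2norm_ge0 ?sqrtr_ge0. Qed.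

Lemma enormD u w : enorm (u + w) <= enorm u + enorm w.
Proof.
by rewrite /enorm -mulrDl ler_wpM2r ?invr_ge0 ?sqrtr_ge0 // l2normD.
Qed.

Lemma enormN u : enorm (- u) = enorm u.
Proof. by rewrite /enorm l2normN. Qed.

Lemma enormZ (a : R) u : enorm (a *: u) = `|a| * enorm u.
Proof. by rewrite /enorm l2normZ mulrA. Qed.

Lemma dot_le_enorm u w : dot u w / n%:R <= enorm u * enorm w.
Proof.
rewrite /enorm mulrACA -invfM -expr2 sqr_sqrtr //.
by rewrite ler_wpM2r ?invr_ge0 // cauchy_schwarz.
Qed.

Lemma mulmx_dot m (u v : 'cV[R]_m) : (u^T *m v) 0 0 = dot u v.
Proof. by rewrite mxE; apply: eq_bigr => i _; rewrite mxE. Qed.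

Lemma qform_enorm b : qform X b = enorm (X *m b) ^+ 2.
Proof.
rewrite enorm_sqr l2norm_dot -mulmx_dot /qform /gram.
by rewrite -scalemxAr -scalemxAl mxE trmx_mul !mulmxA mulrC.
Qed.

Lemma qform_delta j : qform X (delta_mx j 0) = gram X j j.
Proof. by rewrite /qform trmx_delta -rowE -colE !mxE. Qed.

Lemma delta_restr j S : j \in S -> restr (delta_mx j 0 : 'cV[R]_p) S = delta_mx j 0.
Proof.
move=> jS; apply/colP => i; rewrite !mxE; case: ifP => //.
by case: eqP => // ->; rewrite jS.
Qed.

Lemma delta_restrC j S :
  j \in S -> restr (delta_mx j 0 : 'cV[R]_p) (~: S) = 0.
Proof.
move=> jS; apply/colP => i; rewrite !mxE inE.
by case: eqP => [->|_]; rewrite ?jS //= if_same.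
Qed.

Lemma l2norm_delta (j : 'I_p) : l2norm (delta_mx j 0 : 'cV[R]_p) = 1.
Proof.
rewrite /l2norm (bigD1 j) //= big1 ?mxE ?eqxx ?addr0 ?expr1n ?sqrtr1 //.
by move=> i /negbTE ij; rewrite mxE ij expr0n.
Qed.

Lemma inf_ge0 (E : set R) : (forall x, E x -> 0 <= x) -> 0 <= inf E.
Proof.
move=> E0; have [->|/set0P En] := eqVneq E set0; first by rewrite inf0.
exact: lb_le_inf.
Qed.

Lemma ratio_ge0 b N : 0 <= qform X b / l2norm (restr b N) ^+ 2.
Proof. by rewrite qform_enorm divr_ge0 // sqr_ge0. Qed.

Lemma phi2_ge0 L S (k : nat) : 0 <= phi2 X L S k.
Proof. by apply: inf_ge0 => _ [N [b [_ _ _ _ ->]]]; exact: ratio_ge0. Qed.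

Lemma phi_sqr L S (k : nat) : phi X L S k ^+ 2 = phi2 X L S k.
Proof. by rewrite sqr_sqrtr // phi2_ge0. Qed.

Lemma phi_ge0 L S (k : nat) : 0 <= phi X L S k.
Proof. exact: sqrtr_ge0. Qed.

Lemma phi2_lb L S (k : nat) N b :
  S \subset N -> (#|N| <= k)%N -> cone L S N b -> restr b N != 0 ->
  phi2 X L S k <= qform X b / l2norm (restr b N) ^+ 2.
Proof.
move=> SN Nk cb b0; apply: ge_inf; last by exists N, b.
by exists 0 => _ [N' [b' [_ _ _ _ ->]]]; exact: ratio_ge0.
Qed.

(** Multiplied out, the bound also covers [restr b N = 0]. *)
Lemma phi_le_cone L S (k : nat) N b :
  S \subset N -> (#|N| <= k)%N -> cone L S N b ->
  phi X L S k * l2norm (restr b N) <= enorm (X *m b).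
Proof.
move=> SN Nk cb; have [b0|b0] := eqVneq (restr b N) 0.
  by rewrite b0 l2norm0 mulr0 enorm_ge0.
rewrite -ler_sqr ?nnegrE ?enorm_ge0 ?mulr_ge0 ?l2norm_ge0 ?phi_ge0 //.
rewrite exprMn phi_sqr -qform_enorm -ler_pdivlMr ?phi2_lb //.
by rewrite exprn_gt0 // lt0r l2norm_eq0 b0 l2norm_ge0.
Qed.

(** After cancelling [B :&: C], the remainders have equal cardinality and every term on [C :\: B] is
    at most every term on [B :\: C]; comparing double sums replaces the choice of a bijection. *)
Lemma sum_top_subset (T : finType) (f : T -> R) (A B C : {set T}) :
  (forall i j, i \in A :\: B -> j \in B -> f i <= f j) ->
  C \subset A -> #|C| = #|B| ->
  \sum_(i in C) f i <= \sum_(i in B) f i.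
Proof.
move=> top CA CB; have CBk : #|C :\: B| = #|B :\: C|.
  by rewrite !cardsD CB finset.setIC.
rewrite (big_setID B) /= [leRHS](big_setID C) /= finset.setIC lerD2l.
have [C0|C0] := posnP #|C :\: B|.
  have B0 := esym CBk; rewrite C0 in B0.
  by rewrite (cards0_eq C0) (cards0_eq B0) !big_set0.
have k0 : 0 < #|C :\: B|%:R :> R by rewrite ltr0n.
rewrite -(ler_pM2l k0) {1}CBk !mulr_natl -!sumr_const exchange_big /=.
apply: ler_sum => i /finset.setDP[iC iB].
apply: ler_sum => j /finset.setDP[jB _]; apply: top => //.
by rewrite inE iB (fintype.subsetP CA).
Qed.

(* Exchanging the coordinates in [N :\: S] for the largest ones outside [S]
   keeps the l1 constraint and can only increase the l2 norm on [N], which is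
   why the ordering constraint of [cone] is not needed here. *)
Lemma phi_le_restricted L S N b :
  0 <= L -> S \subset N ->
  l1norm (restr b (~: N)) <= L * Num.sqrt #|N|%:R * l2norm (restr b N) ->
  phi X L S #|N| * l2norm (restr b N) <= enorm (X *m b).
Proof.
move=> L0 SN bN.
have kle : (#|N :\: S| <= #|~: S|)%N.
  by rewrite subset_leq_card //; apply/fintype.subsetP => i; rewrite !inE => /andP[].
have [T [TS Tk top]] := @ex_top_subset _ R _ (fun j => `|b j 0|) (~: S) _ kle.
have ST : S :&: T = finset.set0.
  apply/setP => i; rewrite !inE; apply/negbTE/andP => -[iS /(fintype.subsetP TS)].
  by rewrite inE iS.
pose M := S :|: T.
have Mk : #|M| = #|N|.
  rewrite cardsU ST cards0 subn0 Tk cardsD (finset.setIidPr SN) subnKC //.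
  exact: subset_leq_card.
(* A single exchange serves both for the absolute values and for the squares of the entries, which
   are largest on the same indices. *)
have sums (f : 'I_p -> R) :
    (forall i j, i \in ~: S :\: T -> j \in T -> f i <= f j) ->
    \sum_(i in N) f i <= \sum_(i in M) f i.
  move=> ftop; rewrite (big_setID S) /= [leRHS](big_setID S) /=.
  rewrite (finset.setIidPr SN) (finset.setIidPr (finset.subsetUl S T)) lerD2l.
  have -> : M :\: S = T.
    apply/setP => i; rewrite !inE; case: (boolP (i \in T)) => [iT|].
      by move/fintype.subsetP: TS => /(_ _ iT); rewrite inE => ->; rewrite orbT.
    by rewrite orbF andNb.
  apply: (sum_top_subset ftop); last by rewrite Tk.
  by apply/fintype.subsetP => i; rewrite !inE => /andP[].
have M1 : l1norm (restr b N) <= l1norm (restr b M).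
  by rewrite !l1norm_restrE; exact: sums.
have M2 : l2norm (restr b N) <= l2norm (restr b M).
  rewrite -ler_sqr ?nnegrE ?l2norm_ge0 // !l2norm_restrE; apply: sums => i j iT jT.
  have := top i j iT jT.
  by rewrite -ler_sqr ?nnegrE // !real_normK ?num_real.
apply: (@le_trans _ _ (phi X L S #|N| * l2norm (restr b M))).
  by rewrite ler_wpM2l ?phi_ge0.
rewrite -Mk; apply: phi_le_cone => //; first exact: finset.subsetUl.
split.
  (* The total l1 norm is fixed, so more mass on [M] leaves less off [M]. *)
  apply: (@le_trans _ _ (l1norm (restr b (~: N)))).
    have := l1norm_split b N; rewrite (l1norm_split b M); lra.
  apply: le_trans bN _; rewrite Mk; apply: ler_wpM2l => //.
  by rewrite mulr_ge0 ?sqrtr_ge0.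
move=> j k jM; rewrite !inE => /andP[kS /orP[|kT]]; first by rewrite (negbTE kS).
by apply: top; move: jM; rewrite !inE // negb_or andbC.
Qed.

Lemma cone_delta L S j : 0 <= L -> j \in S -> cone L S S (delta_mx j 0 : 'cV[R]_p).
Proof.
move=> L0 jS; split; last by move=> ? k _; rewrite finset.setDv inE.
rewrite delta_restrC // /l1norm big1 => [|i _]; last by rewrite mxE normr0.
by rewrite !mulr_ge0 ?sqrtr_ge0 ?l2norm_ge0.
Qed.

Lemma phi2_feasible L S (k : nat) :
  0 <= L -> (0 < #|S| <= k)%N ->
  ([set x | exists (N : {set 'I_p}) (b : 'cV[R]_p),
         [/\ S \subset N, (#|N| <= k)%N, cone L S N b, restr b N != 0
           & x = qform X b / l2norm (restr b N) ^+ 2] ] !=set0)%classic.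
Proof.
move=> L0 /andP[/card_gt0P[j jS] Sk].
exists (qform X (delta_mx j 0) / l2norm (restr (delta_mx j 0) S) ^+ 2).
exists S, (delta_mx j 0); split=> //; first exact: cone_delta.
by rewrite delta_restr // -l2norm_eq0 l2norm_delta oner_eq0.
Qed.

(** A larger size enlarges the feasible set. Feasibility at [k] matters because the infimum of the
    empty set is 0. *)
Lemma phi_mono L S (k k' : nat) :
  0 <= L -> (0 < #|S| <= k)%N -> (k <= k')%N -> phi X L S k' <= phi X L S k.
Proof.
move=> L0 Sk kk; apply: ler_wsqrtr; apply: lb_le_inf; first exact: phi2_feasible.
move=> _ [N [b [SN Nk cb b0 ->]]]; apply: phi2_lb => //; exact: leq_trans kk.
Qed.

(** A basis vector with index in [S] lies in the cone and has quotient 1 by the normalization of the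
    Gram matrix. *)
Lemma phi_le1 L S (k : nat) :
  (forall j, gram X j j = 1) -> 0 <= L -> (0 < #|S| <= k)%N ->
  phi X L S k <= 1.
Proof.
move=> gram1 L0 /andP[/card_gt0P[j jS] Sk].
have := phi_le_cone (subxx S) Sk (cone_delta L0 jS).
rewrite delta_restr // l2norm_delta mulr1 => /le_trans; apply.
rewrite -ler_sqr ?nnegrE ?enorm_ge0 // -qform_enorm qform_delta gram1.
by rewrite expr1n.
Qed.

Lemma phi_card_sqr L N : phi_card X L N ^+ 2 = phi2 X L N #|N|.
Proof. exact: phi_sqr. Qed.

(** For one inequality, the ordering constraint relative to [S] is dropped by [phi_le_restricted].
    For the other, a feasible set is enlarged to size [k], which preserves the l1 constraint and
    lowers the quotient. *)
Lemma phi_minE L S (k : nat) :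
  0 <= L -> (0 < #|S|)%N -> (#|S| <= k <= p)%N ->
  phi_min X L S k = phi X L S k.
Proof.
move=> L0 S0 /andP[Sk kp].
have [N0 SN0 N0k] : exists2 N : {set 'I_p}, S \subset N & #|N| = k.
  by apply: ex_superset; rewrite Sk card_ord.
congr Num.sqrt; apply/eqP; rewrite eq_le; apply/andP; split; last first.
  apply: lb_le_inf; first by exists (phi_card X L N0 ^+ 2), N0.
  move=> _ [N [SN Nk] <-]; rewrite phi_card_sqr Nk.
  apply: lb_le_inf; first by apply: phi2_feasible; rewrite // Nk leqnn (leq_trans S0).
  move=> _ [N' [b [NN' Nk' [cb _] b0 ->]]].
  (* In [phi_card] the size bound equals [#|N|], so the only admissible superset of [N] is [N]
     itself. *)
  have eN : N = N' by apply/eqP; rewrite eqEcard NN' Nk.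
  rewrite -{}eN in cb b0 *.
  rewrite ler_pdivlMr ?exprn_gt0 ?lt0r ?l2norm_eq0 ?b0 ?l2norm_ge0 //.
  rewrite -phi_sqr qform_enorm -exprMn ler_sqr ?nnegrE ?enorm_ge0 //.
    by rewrite -Nk; exact: phi_le_restricted.
  by rewrite mulr_ge0 ?phi_ge0 ?l2norm_ge0.
apply: lb_le_inf; first by apply: phi2_feasible; rewrite // S0.
move=> _ [N' [b [SN' Nk' [cb _] b0 ->]]].
have [N N'N Nk] : exists2 N : {set 'I_p}, N' \subset N & #|N| = k.
  by apply: ex_superset; rewrite Nk' card_ord.
have b2 := l2norm_restrS b N'N.
have b'0 : 0 < l2norm (restr b N') by rewrite lt0r l2norm_eq0 b0 l2norm_ge0.
have bN0 : 0 < l2norm (restr b N) := lt_le_trans b'0 b2.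
apply: (@le_trans _ _ (phi_card X L N ^+ 2)).
  apply: ge_inf; first by exists 0 => _ [? _ <-]; exact: sqr_ge0.
  by exists N => //; split=> //; exact: fintype.subset_trans N'N.
apply: (@le_trans _ _ (qform X b / l2norm (restr b N) ^+ 2)).
  rewrite phi_card_sqr; apply: phi2_lb => //; last by rewrite -l2norm_eq0 gt_eqF.
  split; last by move=> ? j _; rewrite finset.setDv inE.
  apply: le_trans (l1norm_restrS b (_ : ~: N \subset ~: N')) _.
    by rewrite finset.setCS.
  apply: le_trans cb _; apply: ler_pM; rewrite ?mulr_ge0 ?sqrtr_ge0 ?l2norm_ge0 //.
  by rewrite ler_wpM2l // ler_wsqrtr // ler_nat subset_leq_card.
rewrite ler_wpM2l ?qform_enorm ?sqr_ge0 // lef_pV2 ?posrE ?exprn_gt0 //.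
by rewrite ler_sqr ?nnegrE ?l2norm_ge0.
Qed.

(** * Sparse eigenvalues *)

Lemma qform_bounded : exists2 B : R, 0 <= B &
  forall b, l2norm b = 1 -> qform X b <= B.
Proof.
(* The entries of a unit vector are at most 1 in absolute value. Any bound would do: it only ensures
   that the suprema below are taken over bounded sets. *)
exists ((\sum_(i < n) (\sum_(j < p) `|X i j|) ^+ 2) / n%:R).
  by rewrite divr_ge0 // sumr_ge0 // => i _; exact: sqr_ge0.
move=> b b1; rewrite qform_enorm enorm_sqr ler_wpM2r ?invr_ge0 //.
rewrite l2norm_sqr; apply: ler_sum => i _.
rewrite -[leLHS](real_normK (num_real _)) ler_sqr ?nnegrE ?sumr_ge0 //.
rewrite mxE; apply: le_trans (ler_norm_sum _ _ _) _; apply: ler_sum => j _.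
rewrite normrM ler_piMr // -[leRHS]b1 -ler_sqr ?nnegrE ?l2norm_ge0 //.
rewrite real_normK ?num_real // l2norm_sqr (bigD1 j) //= lerDl.
by rewrite sumr_ge0 // => k _; exact: sqr_ge0.
Qed.

Lemma Lambda_max2_ub S : has_ubound
  [set qform X (restr b S) | b in [set b | l2norm (restr b S) = 1]]%classic.
Proof. by have [B _ bB] := qform_bounded; exists B => _ [b b1 <-]; exact: bB. Qed.

Lemma Lambda_max_bounded : exists2 B : R, 0 <= B &
  forall S, Lambda_max X S <= Num.sqrt B.
Proof.
have [B B0 bB] := qform_bounded; exists B => // S; apply: ler_wsqrtr.
rewrite /Lambda_max2; set E := (X in sup X).
have [->|/set0P En] := eqVneq E set0; first by rewrite sup0.
by apply: ge_sup => // _ [b b1 <-]; exact: bB.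
Qed.

Lemma Lambda_max_le_sparse S : Lambda_max X S <= Lambda_sparse X #|S|.
Proof.
apply: ub_le_sup; last by exists S.
by have [B _ bB] := Lambda_max_bounded; exists (Num.sqrt B) => _ [N _ <-].
Qed.

Lemma Lambda_sparse_ge0 (k : nat) : 0 <= Lambda_sparse X k.
Proof.
rewrite /Lambda_sparse; set E := (X in sup X).
have [->|/set0P[_ [S Sk _]]] := eqVneq E set0; first by rewrite sup0.
by rewrite /E -Sk; apply: le_trans (Lambda_max_le_sparse S); exact: sqrtr_ge0.
Qed.

Lemma enorm_le_Lambda_sparse S v :
  restr v S = v -> enorm (X *m v) <= Lambda_sparse X #|S| * l2norm v.
Proof.
move=> vS; have [->|v0] := eqVneq v 0.
  by rewrite mulmx0 /enorm !l2norm0 mul0r mulr0.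
have vn0 : 0 < l2norm v by rewrite lt0r l2norm_eq0 v0 l2norm_ge0.
apply: le_trans (_ : _ <= Lambda_max X S * l2norm v) _; last first.
  by rewrite ler_wpM2r ?l2norm_ge0 ?Lambda_max_le_sparse.
rewrite -ler_pdivrMr //.
pose w := (l2norm v)^-1 *: v.
have wS : restr w S = w by rewrite /w restrZ vS.
have -> : enorm (X *m v) / l2norm v = enorm (X *m w).
  by rewrite /w -scalemxAr enormZ ger0_norm ?invr_ge0 ?l2norm_ge0 // mulrC.
rewrite -[leLHS]ger0_norm ?enorm_ge0 // -sqrtr_sqr; apply: ler_wsqrtr.
apply: ub_le_sup; first exact: Lambda_max2_ub.
exists w => /=; last by rewrite wS qform_enorm.
by rewrite wS l2normZ ger0_norm ?invr_ge0 ?l2norm_ge0 // mulVf ?gt_eqF.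
Qed.

Lemma Lambda_sparse_ge1 S :
  (forall j, gram X j j = 1) -> (0 < #|S|)%N -> 1 <= Lambda_sparse X #|S|.
Proof.
move=> gram1 /card_gt0P[j jS].
have := enorm_le_Lambda_sparse (delta_restr jS).
rewrite l2norm_delta mulr1; apply: le_trans.
rewrite -ler_sqr ?nnegrE ?enorm_ge0 // -qform_enorm qform_delta gram1.
by rewrite expr1n.
Qed.

Lemma Lambda_min_le S v :
  restr v S = v -> Lambda_min X S * l2norm v <= enorm (X *m v).
Proof.
move=> vS; have [->|v0] := eqVneq v 0.
  by rewrite mulmx0 /enorm !l2norm0 mul0r mulr0.
have vn0 : 0 < l2norm v by rewrite lt0r l2norm_eq0 v0 l2norm_ge0.
rewrite -ler_pdivlMr //.
pose w := (l2norm v)^-1 *: v.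
have wS : restr w S = w by rewrite /w restrZ vS.
have -> : enorm (X *m v) / l2norm v = enorm (X *m w).
  by rewrite /w -scalemxAr enormZ ger0_norm ?invr_ge0 ?l2norm_ge0 // mulrC.
rewrite -[leRHS]ger0_norm ?enorm_ge0 // -sqrtr_sqr; apply: ler_wsqrtr.
apply: ge_inf; first by exists 0 => _ [b _ <-]; rewrite qform_enorm sqr_ge0.
exists w => /=; last by rewrite wS qform_enorm.
by rewrite wS l2normZ ger0_norm ?invr_ge0 ?l2norm_ge0 // mulVf ?gt_eqF.
Qed.

Lemma phi_sparse_le S N v : S \subset N -> restr v N = v ->
  phi_sparse X S #|N| * l2norm v <= enorm (X *m v).
Proof.
move=> SN vN; apply: le_trans (Lambda_min_le vN).
rewrite ler_wpM2r ?l2norm_ge0 //; apply: ge_inf; last by exists N.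
by exists 0 => _ [? _ <-]; exact: sqrtr_ge0.
Qed.

(** A vector supported on [N] satisfies the l1 constraint with left side 0, so [phi_le_restricted]
    applies to it. *)
Lemma phi_le_phi_sparse L S (k : nat) :
  0 <= L -> (0 < #|S|)%N -> (#|S| <= k <= p)%N ->
  phi X L S k <= phi_sparse X S k.
Proof.
move=> L0 S0 /andP[Sk kp].
have [N0 SN0 N0k] : exists2 N : {set 'I_p}, S \subset N & #|N| = k.
  by apply: ex_superset; rewrite Sk card_ord.
apply: lb_le_inf; first by exists (Lambda_min X N0), N0.
move=> _ [N [SN Nk] <-]; apply: ler_wsqrtr; apply: lb_le_inf.
  have /card_gt0P[j jN] : (0 < #|N|)%N by rewrite Nk (leq_trans S0).
  exists (qform X (restr (delta_mx j 0) N)), (delta_mx j 0) => //=.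
  by rewrite delta_restr // l2norm_delta.
move=> _ [b /= b1 <-].
have bN : restr (restr b N) N = restr b N by rewrite restrK.
have := @phi_le_restricted L S N (restr b N) L0 SN.
rewrite bN b1 mulr1 Nk => h.
rewrite -phi_sqr qform_enorm ler_sqr ?nnegrE ?phi_ge0 ?enorm_ge0 // h //.
rewrite (_ : restr _ _ = 0); last first.
  by apply/colP => i; rewrite !mxE inE; case: (i \in N).
rewrite /l1norm big1 => [|i _]; last by rewrite mxE normr0.
by rewrite mulr1 mulr_ge0 ?sqrtr_ge0.
Qed.

(* The [s] largest coordinates outside [N] are adjoined to [N]: the remaining
   ones are then at most the average of these, so have l2 norm at most
   [l1norm v / sqrt s]. *)
Lemma l2norm_le_cone L S N v (s : nat) :
  1 <= L -> (0 < s)%N -> S \subset N -> (#|N| + s <= p)%N ->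
  0 < phi X L S (#|N| + s) ->
  l2norm v <= enorm (X *m v) / phi X L S (#|N| + s)
              + 2 * (l1norm v / Num.sqrt s%:R).
Proof.
move=> L1 s0 SN Nsp phi0.
have s0R : 0 < s%:R :> R by rewrite ltr0n.
have rs0 : 0 < Num.sqrt s%:R :> R by rewrite sqrtr_gt0.
have sN : (s <= #|~: N|)%N
  by rewrite cardsCs finset.setCK card_ord leq_subRL ?(leq_trans _ Nsp) ?leq_addr.
have [T [TN Tk top]] := @ex_top_subset _ R _ (fun j => `|v j 0|) (~: N) _ sN.
pose M := N :|: T.
have Mk : #|M| = (#|N| + s)%N.
  rewrite cardsU (_ : N :&: T = finset.set0) ?cards0 ?subn0 ?Tk //.
  apply/setP => i; rewrite !inE; apply/negbTE/andP => -[iS /(fintype.subsetP TN)].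
  by rewrite inE iS.
pose q := l1norm v / Num.sqrt s%:R.
have q0 : 0 <= q by rewrite divr_ge0 ?l1norm_ge0 ?sqrtr_ge0.
have q2 : q ^+ 2 = l1norm v * (l1norm v / s%:R).
  by rewrite /q expr_div_n sqr_sqrtr // expr2 mulrA.
have tail : l2norm (restr v (~: M)) <= q.
  rewrite -ler_sqr ?nnegrE ?l2norm_ge0 // q2.
  apply: (@le_trans _ _ (l1norm (restr v (~: M)) * (l1norm v / s%:R))); last first.
    by rewrite ler_wpM2r ?divr_ge0 ?l1norm_ge0 ?l1norm_restr_le.
  rewrite l2norm_restrE l1norm_restrE mulr_suml; apply: ler_sum => i iM.
  rewrite -(real_normK (num_real (v i 0))) expr2 ler_wpM2l //.
  rewrite ler_pdivlMr //; apply: le_trans (l1norm_restr_le v T).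
  rewrite l1norm_restrE -Tk mulr_natr -sumr_const; apply: ler_sum => j jT.
  by apply: top => //; move: iM; rewrite !inE negb_or andbC.
have head : l2norm (restr v M) <= enorm (X *m v) / phi X L S (#|N| + s) + q.
  have [c|c] := leP (l1norm (restr v (~: M)))
                    (L * Num.sqrt #|M|%:R * l2norm (restr v M)).
    apply: le_trans (_ : _ <= enorm (X *m v) / phi X L S (#|N| + s)) _.
      rewrite ler_pdivlMr // mulrC -Mk; apply: phi_le_restricted => //.
        exact: le_trans L1.
      exact: fintype.subset_trans (finset.subsetUl _ _).
    by rewrite lerDl.
  (* Outside the cone the l1 norm off [M] exceeds [sqrt #|M|] times the l2 norm on [M], and
     [s <= #|M|]. *)
  apply: le_trans (_ : _ <= q) _; last by rewrite lerDr divr_ge0 ?enorm_ge0 ?phi_ge0.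
  rewrite /q ler_pdivlMr //; apply: le_trans (l1norm_restr_le v (~: M)).
  apply: le_trans (ltW c); rewrite mulrC ler_wpM2r ?l2norm_ge0 //.
  rewrite -[leLHS]mul1r ler_pM ?sqrtr_ge0 // ler_wsqrtr //.
  by rewrite ler_nat Mk leq_addl.
have := l2normD (restr v M) (restr v (~: M)); rewrite -restr_splitE -/q; lra.
Qed.

End Design.

(** * Basic inequality and stationarity *)

Section Estimators.
Set Implicit Arguments.
Unset Strict Implicit.
Variables (R : realType) (n p : nat) (X : 'M[R]_(n, p)).
Variables (f0 eps : 'cV[R]_n) (lam : R).
Hypothesis noise : noise_event X lam eps.
Let Y := f0 + eps.

(** Duality of the l1 and sup norms: each column contributes at most [lam / 4], and the factor 2
    gives [lam / 2]. *)
Lemma noise_dot v : 2 * (dot eps (X *m v) / n%:R) <= lam / 2 * l1norm v.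
Proof.
rewrite dot_mulmx mulr_suml !mulr_sumr; apply: ler_sum => j _.
have bj : `|dot eps (col j X) / n%:R| <= lam / 4.
  rewrite ler_pdivlMr // mulrC; apply: le_trans noise; rewrite ler_wpM2l //.
  rewrite -mulmx_dot.
  exact: (le_bigmax _ (fun j => `|(eps^T *m col j X) 0 0 / n%:R|)).
rewrite -mulrA; apply: le_trans (ler_norm _) _; rewrite !normrM normr_nat.
rewrite -normrM; have := ler_wpM2l (normr_ge0 (v j 0)) bj; lra.
Qed.

(** Both losses are expanded around [f0]; the squared norm of the noise cancels. *)
Lemma loss_diff b b' :
  loss X Y b - loss X Y b' =
    enorm (X *m b - f0) ^+ 2 - enorm (X *m b' - f0) ^+ 2
    - 2 * (dot eps (X *m (b - b')) / n%:R).
Proof.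
have lossE v : loss X Y v =
    enorm (X *m v - f0) ^+ 2 - 2 * (dot eps (X *m v - f0) / n%:R)
    + l2norm eps ^+ 2 / n%:R.
  rewrite /loss enorm_sqr (_ : Y - X *m v = eps + - (X *m v - f0)); last first.
    by rewrite /Y opprB [f0 + eps]addrC addrA.
  by rewrite l2norm_sqrD l2normN dotNr; ring.
rewrite !lossE (_ : X *m (b - b') = (X *m b - f0) + - (X *m b' - f0)); last first.
  by rewrite mulmxBr opprB addrA subrK.
by rewrite (dotDr _ (X *m b - f0)) dotNr; ring.
Qed.

(** The slack [d] carries the difference of penalties, so that one inequality serves the Lasso, the
    thresholded estimator ([d = 0]) and the adaptive Lasso. *)
Lemma basic_inequality b b' (d : R) :
  loss X Y b <= loss X Y b' + d ->
  enorm (X *m b - f0) ^+ 2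
    <= enorm (X *m b' - f0) ^+ 2 + d + lam / 2 * l1norm (b - b').
Proof.
have := loss_diff b b'; have := noise_dot (b - b'); lra.
Qed.

(** Shrinking [b j 0] to [(1 - t) * b j 0] keeps [b] admissible and lowers the penalty linearly in
    [t], while the loss changes by a linear and a quadratic term. Minimality for small [t] gives the
    inequality. *)
Lemma adaptive_lasso_kkt binit mu b j :
  is_adaptive_lasso X Y binit lam mu b -> b j 0 != 0 ->
  lam * mu / `|binit j 0|
    <= 2 * Num.sg (b j 0) * (dot (Y - X *m b) (col j X) / n%:R).
Proof.
move=> [bD bmin] bj0.
have binit0 : binit j 0 != 0 by apply: contra_neq bj0 => /bD.
have bj : 0 < `|b j 0| by rewrite normr_gt0.
pose P (t : R) := b + (- (t * b j 0)) *: delta_mx j 0.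
pose D := dot (Y - X *m b) (col j X) / n%:R.
pose q := lam * mu / `|binit j 0|.
pose g := gram X j j * `|b j 0|.
have key t : 0 < t -> t <= 1 -> q <= 2 * Num.sg (b j 0) * D + t * g.
  move=> t0 t1.
  have PE i : P t i 0 = if i == j then (1 - t) * b j 0 else b i 0.
    rewrite !mxE eqxx andbT; case: eqP => [->|_] /=; first by ring.
    by rewrite mulr0 addr0.
  have := bmin (P t); have PD : forall i, binit i 0 = 0 -> P t i 0 = 0.
    by move=> i i0; rewrite PE; case: eqP => [ij|_]; [rewrite -ij (bD i) ?mulr0|exact: bD].
  move/(_ PD).
  have -> : loss X Y (P t) = loss X Y b + 2 * (t * b j 0) * D
                             + (t * b j 0) ^+ 2 * gram X j j.
    rewrite /loss (_ : Y - X *m P t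
       = (Y - X *m b) + (t * b j 0) *: (X *m delta_mx j 0)); last first.
      by rewrite /P mulmxDr -scalemxAr scaleNr opprD opprK addrA.
    rewrite l2norm_sqrD l2normZ exprMn real_normK ?num_real //.
    by rewrite -qform_delta qform_enorm enorm_sqr dotZr -colE /D; ring.
  rewrite (bigD1 j) //= [in leRHS](bigD1 j) //= PE eqxx normrM.
  rewrite (ger0_norm (_ : 0 <= 1 - t)); last by rewrite subr_ge0.
  set rest := (X in _ + lam * mu * (_ + X) <= _).
  rewrite [X in _ <= _ + lam * mu * (_ + X)](_ : _ = rest); last first.
    by apply: eq_bigr => i /andP[_ /negbTE ij]; rewrite PE ij.
  move=> h.
  have h' : t * `|b j 0| * q <= t * `|b j 0| * (2 * Num.sg (b j 0) * D + t * g).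
    have -> : t * `|b j 0| * (2 * Num.sg (b j 0) * D + t * g) =
        2 * (t * b j 0) * D + (t * b j 0) ^+ 2 * gram X j j.
      have -> : 2 * (t * b j 0) * D = 2 * (t * (Num.sg (b j 0) * `|b j 0|)) * D.
        by rewrite -numEsg.
      by rewrite exprMn -(real_normK (num_real (b j 0))) /g; ring.
    move: h; rewrite /q; lra.
  by move: h'; rewrite ler_pM2l // mulr_gt0.
have g0 : 0 <= g.
  by rewrite mulr_ge0 // -qform_delta qform_enorm sqr_ge0.
rewrite -/q -/D leNgt; apply/negP => hlt.
(* An explicit step replaces the limit: for this [t] the term [t * g] is smaller than the supposed
   gap. Adding 1 to [g] keeps the denominator positive. *)
pose t := Num.min 1 ((q - 2 * Num.sg (b j 0) * D) / (2 * (g + 1))).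
have g1 : 0 < 2 * (g + 1) by lra.
have t0 : 0 < t by rewrite lt_min ltr01 divr_gt0 // subr_gt0.
have t1 : t <= 1 by rewrite ge_min lexx.
have tle : t * (2 * (g + 1)) <= q - 2 * Num.sg (b j 0) * D.
  by rewrite -ler_pdivlMr // ge_min lexx orbT.
have := key t t0 t1; nra.
Qed.

End Estimators.

(** * Error bounds *)

Section ErrorBounds.
Set Implicit Arguments.
Unset Strict Implicit.
Variables (R : realType) (n p : nat) (X : 'M[R]_(n, p)).
Variables (f0 eps : 'cV[R]_n) (lam A : R) (S0 : {set 'I_p}) (b0 binit : 'cV[R]_p).
Local Notation s := #|S0|.
Local Notation r := (Num.sqrt (s%:R : R)).
Local Notation kappa := (phi X 6 S0 (2 * s)).
Local Notation Lam := (Lambda_sparse X s).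
Local Notation D := (18 * (1 + A)).
Local Notation err b := (enorm (X *m b - f0)).
Local Notation theta := (lam * r / kappa ^+ 2).

Hypothesis gram1 : forall j, gram X j j = 1.
Hypothesis lam0 : 0 < lam.
Hypothesis A0 : 0 < A.
Hypothesis noise : noise_event X lam eps.
Hypothesis S0gt0 : (0 < s)%N.
Hypothesis S0p : (2 * s <= p)%N.
Hypothesis b0S : restr b0 S0 = b0.
Hypothesis lasso : is_lasso X (f0 + eps) lam binit.
Hypothesis kappa0 : 0 < kappa.
Hypothesis err_b0_sqr : err b0 ^+ 2 <= A * (lam * r / kappa) ^+ 2.

Let r0 : 0 < r.
Proof. by rewrite sqrtr_gt0 ltr0n. Qed.

Let r2 : r ^+ 2 = s%:R.
Proof. by rewrite sqr_sqrtr. Qed.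

Let kappa1 : kappa <= 1.
Proof. by apply: phi_le1; rewrite // S0gt0 leq_pmull. Qed.

Let Lam1 : 1 <= Lam.
Proof. exact: Lambda_sparse_ge1. Qed.

Let theta0 : 0 < theta.
Proof. by rewrite divr_gt0 ?exprn_gt0 // mulr_gt0. Qed.

Let t_le_theta : lam * r / kappa <= theta.
Proof.
rewrite ler_pM2l ?mulr_gt0 // lef_pV2 ?posrE ?exprn_gt0 //.
by rewrite expr2 ler_piMr // ltW.
Qed.

Let t0 : 0 < lam * r / kappa.
Proof. by rewrite divr_gt0 // mulr_gt0. Qed.

(** * Error of the initial Lasso *)

Lemma enorm_mulmxB_le b b' : enorm (X *m (b - b')) <= err b + err b'.
Proof.
rewrite -(enormN (X *m b' - f0)); apply: le_trans (enormD _ _).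
by rewrite mulmxBr opprB addrA subrK.
Qed.

(** The factor [1 + A] stands in for the square root of [A], so that constants remain polynomial in
    [A]. *)
Lemma err_oracle : err b0 <= (1 + A) * (lam * r / kappa).
Proof.
rewrite -ler_sqr ?nnegrE ?enorm_ge0 //; last first.
  by rewrite mulr_ge0 ?(ltW t0) // addr_ge0 // ltW.
apply: le_trans err_b0_sqr _; rewrite [leRHS]exprMn ler_wpM2r ?sqr_ge0 //.
have := A0; nra.
Qed.

Lemma l1norm_supported_le (S : {set 'I_p}) (v : 'cV[R]_p) :
  restr v S = v -> l1norm v <= Num.sqrt #|S|%:R * l2norm v.
Proof. by move=> <-; rewrite -{1}(restrK v (subxx S)) restrK // l1norm_le_l2norm. Qed.

Lemma lasso_error :
  enorm (X *m (binit - b0)) <= 6 * (1 + A) * (lam * r / kappa) /\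
  l1norm (binit - b0) <= 6 * (1 + A) * (lam * s%:R / kappa ^+ 2).
Proof.
set d := binit - b0; set t := lam * r / kappa.
have lt : lam * (lam * s%:R / kappa ^+ 2) = t ^+ 2.
  by rewrite /t expr_div_n exprMn r2; ring.
pose x := err binit; pose E := err b0.
have x0 : 0 <= x := enorm_ge0 _; have E0 : 0 <= E := enorm_ge0 _.
pose dS := l1norm (restr d S0); pose dC := l1norm (restr d (~: S0)).
have dS0 : 0 <= dS := l1norm_ge0 _; have dC0 : 0 <= dC := l1norm_ge0 _.
have dE : l1norm d = dS + dC := l1norm_split d S0.
(* The penalties contribute [lam * (dS - dC)] and the noise [lam / 2 * (dS + dC)]. *)
have basic : x ^+ 2 + lam / 2 * dC <= 3 / 2 * (lam * dS) + E ^+ 2.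
  have [_ min] := lasso.
  have := @basic_inequality R n p X f0 eps lam noise binit b0
            (lam * (l1norm b0 - l1norm binit)).
  rewrite -/d -/x -/E dE.
  have : l1norm b0 - l1norm binit <= dS - dC.
    have bC : restr d (~: S0) = restr binit (~: S0).
      rewrite /d restrD restrN -b0S; apply/colP => i; rewrite !mxE inE.
      by case: (i \in S0); rewrite //= ?oppr0 ?addr0 // subr0.
    have := l1normD (restr binit S0) (- restr d S0).
    rewrite -restrN -restrD /d opprB addrC subrK b0S.
    have -> : l1norm (restr (b0 - binit) S0) = dS.
      rewrite /dS /d -opprB restrN; apply: eq_bigr => i _.
      by rewrite !mxE normrN.
    by rewrite (l1norm_split binit S0) /dC bC; lra.
  move=> h1 h2; have {}h2 := h2 _; have := min b0 I => hm.
  have {h2} : x ^+ 2 <= E ^+ 2 + lam * (l1norm b0 - l1norm binit)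
                      + lam / 2 * (dS + dC) by apply: h2; lra.
  have := ler_wpM2l (ltW lam0) h1; lra.
have sum_le : x ^+ 2 + lam * l1norm d <= 6 * (1 + A) * t ^+ 2.
  have EA : E ^+ 2 <= A * t ^+ 2 := err_b0_sqr.
  have At0 : 0 <= A * t ^+ 2 by rewrite mulr_ge0 ?sqr_ge0 // ltW.
  (* Either the oracle error dominates and bounds every term, or [lam / 2 * dC <= 3 * (lam * dS)],
     which is the cone condition with constant 6. *)
  have [c|c] := leP (E ^+ 2) (3 / 2 * (lam * dS)); last first.
    rewrite dE; have := sqr_ge0 t; have := sqr_ge0 x; have := sqr_ge0 E; lra.
  have lamd : lam * dS <= t * (x + E).
    have cone_d : cone 6 S0 S0 d.
      split; last by move=> ? k _; rewrite finset.setDv inE.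
      rewrite -/dC -mulrA; apply: (@le_trans _ _ (6 * dS)).
        by rewrite -(ler_pM2l lam0); nra.
      by rewrite ler_wpM2l // l1norm_le_l2norm.
    have Sk : (s <= 2 * s)%N by rewrite leq_pmull.
    have h := phi_le_cone X (subxx S0) Sk cone_d.
    have -> : t * (x + E) = lam * (r * ((x + E) / kappa)) by rewrite /t; ring.
    rewrite ler_pM2l //; apply: le_trans (l1norm_le_l2norm _ _) _.
    rewrite ler_pM2l // ler_pdivlMr // mulrC.
    exact: le_trans h (enorm_mulmxB_le _ _).
  rewrite dE; have := sqr_ge0 (x - 2 * t); have := sqr_ge0 (t - E); lra.
have d10 := l1norm_ge0 d.
have ld0 : 0 <= lam * l1norm d by rewrite mulr_ge0 // ltW.
split; last first.
  by rewrite -(ler_pM2l lam0) mulrCA lt; have := sqr_ge0 x; lra.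
rewrite -ler_sqr ?nnegrE ?enorm_ge0 //; last first.
  by apply: mulr_ge0; [have := A0; lra|exact: ltW t0].
have EA : E ^+ 2 <= A * t ^+ 2 := err_b0_sqr.
have dxE : enorm (X *m d) <= x + E := enorm_mulmxB_le _ _.
apply: (@le_trans _ _ ((x + E) ^+ 2)).
  by rewrite ler_sqr ?nnegrE ?enorm_ge0 ?addr_ge0.
apply: (@le_trans _ _ (2 * x ^+ 2 + 2 * E ^+ 2)).
  by have := sqr_ge0 (x - E); lra.
apply: (@le_trans _ _ ((12 + 14 * A) * t ^+ 2)); first by lra.
by rewrite [leRHS]exprMn ler_wpM2r ?sqr_ge0 //; have := A0; nra.
Qed.

(** [l2norm_le_cone] with [N = S0]: the prediction part contributes 6 and twice the l1 part
    contributes 12, whence the 18 in [D]. *)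
Lemma lasso_l2_error : l2norm (binit - b0) <= D * theta.
Proof.
have [h1 h2] := lasso_error.
have k2 : (s + s = 2 * s)%N by rewrite mul2n addnn.
have := @l2norm_le_cone R n p X 6 S0 S0 (binit - b0) s.
rewrite k2 => /(_ _ S0gt0 (subxx _) S0p kappa0) h.
apply: le_trans (h _) _; first by rewrite ler1n.
have h1' : enorm (X *m (binit - b0)) / kappa <= 6 * (1 + A) * theta.
  rewrite ler_pdivrMr //; apply: le_trans h1 _.
  rewrite le_eqVlt; apply/predU1P; left; field.
  by rewrite gt_eqF.
have h2' : l1norm (binit - b0) / r <= 6 * (1 + A) * theta.
  rewrite ler_pdivrMr //; apply: le_trans h2 _.
  rewrite le_eqVlt; apply/predU1P; left.
  by rewrite -[in LHS]r2; field; rewrite gt_eqF.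
lra.
Qed.

(** Since [b0] vanishes outside [S0], each counted coordinate contributes at least [tau ^+ 2] to a
    squared error that is at most [s * tau ^+ 2]. *)
Lemma card_thres_setD (tau : R) :
  0 < tau -> D * theta <= tau * r ->
  (#|thres_set binit tau :\: S0| <= s)%N.
Proof.
move=> tau0 htau.
have h : #|thres_set binit tau :\: S0|%:R * tau ^+ 2 <= l2norm (binit - b0) ^+ 2.
  apply: card_le_of_l2norm; first exact: ltW.
  move=> j; rewrite !inE => /andP[jS /ltW jt]; rewrite !mxE.
  by rewrite -b0S mxE (negbTE jS) subr0.
have h2 : l2norm (binit - b0) ^+ 2 <= s%:R * tau ^+ 2.
  rewrite mulrC -r2 -exprMn ler_sqr ?nnegrE ?l2norm_ge0 //.
    exact: le_trans lasso_l2_error htau.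
  by rewrite mulr_ge0 ?ltW.
rewrite -(ler_nat R) -(ler_pM2r (_ : 0 < tau ^+ 2)) ?exprn_gt0 //.
exact: le_trans h h2.
Qed.

(** Padding to exactly [2 * s] indices makes [kappa] the constant that [phi_le_restricted] yields
    for [N]. *)
Lemma ex_support_superset (tau : R) :
  0 < tau -> D * theta <= tau * r ->
  exists2 N : {set 'I_p}, S0 :|: thres_set binit tau \subset N & #|N| = (2 * s)%N.
Proof.
move=> tau0 htau; apply: ex_superset; rewrite card_ord S0p andbT.
rewrite cardsU -addnBA ?subset_leq_card ?finset.subsetIr //.
by rewrite mul2n -addnn leq_add2l finset.setIC -cardsD card_thres_setD.
Qed.

(** Supported both on [S0] and where [binit] exceeds [tau], this is an admissible competitor in both
    minimization problems. *)
Local Notation bstar tau := (restr b0 (S0 :&: thres_set binit tau)).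

(** On the removed coordinates, [- b0] is [(binit - b0) - binit]: the first part is controlled by
    the Lasso error, the second by [tau] on at most [s] coordinates. *)
Lemma truncation_l2 (tau : R) :
  0 < tau -> l2norm (bstar tau - b0) <= D * theta + tau * r.
Proof.
move=> tau0; pose S1 := S0 :\: thres_set binit tau.
have -> : bstar tau - b0 = restr (binit - b0) S1 - restr binit S1.
  apply/colP => i; rewrite !mxE -[in LHS]b0S !mxE !inE.
  by case: (i \in S0); case: (tau < _) => //=; ring.
apply: le_trans (l2normD _ _) _; rewrite l2normN; apply: lerD.
  exact: le_trans (l2norm_restr_le _ _) lasso_l2_error.
rewrite -ler_sqr ?nnegrE ?l2norm_ge0 ?mulr_ge0 ?(ltW tau0) ?(ltW r0) //.
rewrite l2norm_restrE exprMn r2.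
apply: (@le_trans _ _ (\sum_(j in S1) tau ^+ 2)).
  apply: ler_sum => j; rewrite !inE -leNgt => /andP[jt _].
  by rewrite -(real_normK (num_real (binit j 0))) ler_sqr ?nnegrE // ltW.
rewrite sumr_const -[leLHS]mulr_natr ler_wpM2l ?sqr_ge0 // ler_nat subset_leq_card //.
exact: finset.subsetDl.
Qed.

(** The truncation only alters coordinates in [S0], hence the factor [Lam]; the error of [b0] itself
    is absorbed because [1 <= Lam]. *)
Lemma truncation_err (tau : R) :
  0 < tau -> err (bstar tau) <= Lam * (2 * D * theta + tau * r).
Proof.
move=> tau0.
have -> : X *m bstar tau - f0 = X *m (bstar tau - b0) + (X *m b0 - f0).
  by rewrite mulmxBr addrA subrK.
apply: le_trans (enormD _ _) _.
have bS : restr (bstar tau - b0) S0 = bstar tau - b0.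
  by rewrite restrD restrN b0S restrK ?finset.subsetIl.
have h1 := enorm_le_Lambda_sparse X bS.
have h2 := ler_wpM2l (Lambda_sparse_ge0 X s) (truncation_l2 tau0).
have h3 : err b0 <= Lam * (D * theta).
  apply: le_trans err_oracle _.
  apply: (@le_trans _ _ (1 * (D * theta))); last first.
    by rewrite ler_wpM2r // mulr_ge0 ?(ltW theta0) //; have := A0; lra.
  rewrite mul1r; apply: ler_pM => //; try exact: ltW; have := A0; lra.
lra.
Qed.

(** * Comparison with the truncated oracle *)

Lemma sqrt_card_le (N : {set 'I_p}) :
  #|N| = (2 * s)%N -> Num.sqrt #|N|%:R <= 2 * r.
Proof.
move=> Nk; rewrite -ler_sqr ?nnegrE ?sqrtr_ge0 ?mulr_ge0 ?(ltW r0) //.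
rewrite exprMn r2 Nk sqr_sqrtr // natrM.
have : 0 <= s%:R :> R by [].
lra.
Qed.

(** The factor [x + e] of [x ^+ 2 - e ^+ 2] cancels. *)
Lemma quadratic_le (x e g : R) :
  0 <= x -> 0 <= e -> 0 <= g ->
  x ^+ 2 <= e ^+ 2 + g * (x + e) -> x <= e + g.
Proof. by move=> x0 e0 g0 h; rewrite leNgt; apply/negP => c; nra. Qed.

(** Both [bt] and the truncated oracle live on a common [N] of size [2 * s], where [phi_sparse]
    turns the l1 norm in the basic inequality back into prediction error. *)
Lemma thres_bounds (K tau : R) bt :
  0 < K -> 0 < tau -> is_thres X (f0 + eps) (thres_set binit tau) bt ->
  D * theta <= tau * r -> tau * r <= K * theta ->
  [/\ err bt <= (2 * D + K + 1) * (Lam * theta),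
      phi_sparse X S0 (2 * s) * l2norm (bt - b0)
        <= (3 * D + K + 1) * (Lam * theta)
    & l1norm (bt - b0) <= 2 * r * l2norm (bt - b0)].
Proof.
move=> K0 tau0 [btT btmin] tau_ge tau_le.
have [N SN Nk] := ex_support_superset tau0 tau_ge.
have rN := sqrt_card_le Nk.
have /fintype.subsetP S0N := fintype.subset_trans (finset.subsetUl _ _) SN.
have /fintype.subsetP TN := fintype.subset_trans (finset.subsetUr _ _) SN.
have suppN (v : 'cV[R]_p) (S : {set 'I_p}) :
    restr v S = v -> {subset S <= N} -> restr v N = v.
  by move=> <- SsN; rewrite restrK //; apply/fintype.subsetP.
have bt_N : restr bt N = bt := suppN _ _ btT TN.
have b0_N : restr b0 N = b0 := suppN _ _ b0S S0N.
set b1 := bstar tau.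
have b1_N : restr b1 N = b1.
  rewrite restrK //; apply/fintype.subsetP => i /finset.setIP[iS _]; exact: S0N.
set x := err bt; set e := err b1.
have e_le : e <= (2 * D + K) * (Lam * theta).
  apply: le_trans (truncation_err tau0) _.
  have := ler_wpM2l (Lambda_sparse_ge0 X s) tau_le; lra.
have x0 : 0 <= x := enorm_ge0 _; have e0 : 0 <= e := enorm_ge0 _.
set ps := phi_sparse X S0 (2 * s).
have kps : kappa <= ps.
  by apply: phi_le_phi_sparse; rewrite // S0p leq_pmull.
have ps0 : 0 < ps := lt_le_trans kappa0 kps.
have S0sN : S0 \subset N by apply/fintype.subsetP.
have th_le : theta <= Lam * theta by rewrite ler_pMl.
(* The noise level [lam / 2] times the factor [2 * r / ps] between the l1 norm on [N] and prediction
   error. *)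
pose g := lam * r / ps.
have g0 : 0 <= g by rewrite divr_ge0 ?(ltW ps0) // mulr_ge0 // ltW.
have g_le : g <= Lam * theta.
  apply: le_trans th_le; apply: le_trans t_le_theta.
  by rewrite ler_wpM2l ?lef_pV2 // mulr_ge0 // ltW.
have x_le : x <= e + g.
  apply: quadratic_le => //.
  have b1T : supported (thres_set binit tau) b1.
    by rewrite /supported /= restrK // finset.subsetIr.
  have hl : loss X (f0 + eps) bt <= loss X (f0 + eps) b1 + 0.
    by rewrite addr0; exact: btmin.
  have := basic_inequality noise hl; rewrite -/x -/e addr0.
  move/le_trans; apply; rewrite lerD2l.
  have etaN : restr (bt - b1) N = bt - b1 by rewrite restrD restrN bt_N b1_N.
  have h1 := l1norm_supported_le etaN.
  have h2 := phi_sparse_le X S0sN etaN; rewrite Nk -/ps in h2.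
  have h3 : l2norm (bt - b1) <= (x + e) / ps.
    rewrite ler_pdivlMr // mulrC; exact: le_trans h2 (enorm_mulmxB_le _ _).
  have h4 : l1norm (bt - b1) <= 2 * r * ((x + e) / ps).
    by apply: le_trans h1 _; rewrite ler_pM ?sqrtr_ge0 ?l2norm_ge0.
  have -> : g * (x + e) = lam / 2 * (2 * r * ((x + e) / ps)).
    by rewrite /g; field; rewrite gt_eqF.
  by rewrite ler_wpM2l // divr_ge0 // ltW.
have x_bound : x <= (2 * D + K + 1) * (Lam * theta) by lra.
have eta0N : restr (bt - b0) N = bt - b0 by rewrite restrD restrN bt_N b0_N.
split=> //.
  have := phi_sparse_le X S0sN eta0N; rewrite Nk -/ps => /le_trans; apply.
  apply: le_trans (enorm_mulmxB_le _ _) _.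
  have : err b0 <= D * (Lam * theta).
    apply: le_trans err_oracle _; apply: ler_pM.
    - by have := A0; lra.
    - exact: ltW t0.
    - by have := A0; lra.
    - exact: le_trans t_le_theta th_le.
  rewrite -/x; lra.
apply: le_trans (l1norm_supported_le eta0N) _.
by rewrite ler_wpM2r ?l2norm_ge0.
Qed.

(** Coordinatewise: where the truncated oracle may be nonzero the weight is below [1 / tau];
    elsewhere in [N] the difference is nonpositive; outside [N] the oracle is 0 and the weight is at
    least [1 / tau]. *)
Lemma adaptive_penalty_le (tau : R) (b : 'cV[R]_p) (N : {set 'I_p}) :
  0 < tau -> S0 :|: thres_set binit tau \subset N ->
  (forall j, binit j 0 = 0 -> b j 0 = 0) ->
  \sum_(j < p | binit j 0 != 0) `|bstar tau j 0| / `|binit j 0|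
  - \sum_(j < p | binit j 0 != 0) `|b j 0| / `|binit j 0|
  <= (l1norm (restr (b - bstar tau) N)
      - l1norm (restr (b - bstar tau) (~: N))) / tau.
Proof.
move=> tau0 /fintype.subsetP SN bD.
rewrite -sumrB -[X in _ <= X / _]sumrB mulr_suml big_mkcond.
apply: ler_sum => j _.
have jS : j \notin N -> j \notin S0 :&: thres_set binit tau.
  by apply: contra => /finset.setIP[jS _]; apply: SN; rewrite finset.inE jS.
have jG : j \notin N -> `|binit j 0| <= tau.
  move=> jN; rewrite leNgt; apply: contra jN => c; apply: SN.
  by rewrite !finset.inE c orbT.
case: ifPn => [w0|]; last first.
  rewrite negbK => /eqP w0; rewrite !mxE (bD j w0).
  have -> : j \in S0 :&: thres_set binit tau = false.
    by rewrite !finset.inE w0 normr0 ltNge (ltW tau0) andbF.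
  by rewrite subr0 !if_same normr0 subrr mul0r.
have w : 0 < `|binit j 0| by rewrite normr_gt0.
rewrite -mulrBl [restr _ N j 0]mxE [restr _ (~: N) j 0]mxE finset.inE.
have [jN|jN] := boolP (j \in N); last first.
  rewrite !mxE (negbTE (jS jN)) /= normr0 subr0 !sub0r !mulNr lerN2.
  by rewrite ler_wpM2l // lef_pV2 ?posrE // jG.
rewrite /= normr0 subr0 !mxE.
have [/finset.setIP[_]|_] := boolP (j \in S0 :&: thres_set binit tau); last first.
  rewrite normr0 sub0r subr0.
  apply: (@le_trans _ _ 0); first by rewrite mulNr oppr_le0 divr_ge0.
  by rewrite divr_ge0 // ltW.
rewrite finset.inE => jt; apply: (@le_trans _ _ (`|b j 0 - b0 j 0| / `|binit j 0|)).
  by rewrite ler_pM2r ?invr_gt0 // distrC; exact: lerB_dist.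
by rewrite ler_wpM2l // lef_pV2 ?posrE // ltW.
Qed.

(** * The adaptive Lasso *)

Local Notation tau_star := (D * lam / kappa ^+ 2).

Let tau0_gt0 : 0 < tau_star.
Proof. by rewrite divr_gt0 ?exprn_gt0 // mulr_gt0 //; have := A0; lra. Qed.

Let tau0_r : tau_star * r = D * theta.
Proof. by rewrite mulrAC -!mulrA. Qed.

Section Adaptive.
Variables (K mu : R) (b : 'cV[R]_p).
Local Notation X1 := (6 * D + 3 * K).
Local Notation Theta := (Lam * theta).

Hypothesis K0 : 0 < K.
Hypothesis mu_ge : D * (Lam * lam / kappa ^+ 3) <= mu.
Hypothesis mu_le : mu <= K * (Lam * lam / kappa ^+ 3).
Hypothesis adaptive : is_adaptive_lasso X (f0 + eps) binit lam mu b.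

Let D1 : 1 <= D.
Proof. by have := A0; lra. Qed.

Let Lam_gt0 : 0 < Lam.
Proof. exact: lt_le_trans Lam1. Qed.

Let Theta_ge0 : 0 <= Theta.
Proof. by rewrite mulr_ge0 // ltW. Qed.

(** The ratio [mu / tau_star] is the level of the effective l1 penalty in units of [lam]; the factor
    [D] in the lower bound on [mu] cancels the one in [tau_star]. *)
Let rho_ge : Lam / kappa <= mu / tau_star.
Proof.
rewrite ler_pdivlMr //; apply: le_trans mu_ge; rewrite le_eqVlt; apply/predU1P.
by left; field; rewrite gt_eqF.
Qed.

Let rho_le : mu / tau_star <= K * (Lam / kappa).
Proof.
rewrite ler_pdivrMr //; apply: le_trans mu_le _.
have -> : K * (Lam / kappa) * tau_star = D * (K * (Lam * lam / kappa ^+ 3)).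
  by field; rewrite gt_eqF.
by rewrite ler_peMl // mulr_ge0 ?ltW // divr_gt0 ?exprn_gt0 // mulr_gt0.
Qed.

Let rho1 : 1 <= mu / tau_star.
Proof.
apply: le_trans rho_ge; rewrite ler_pdivlMr // mul1r.
exact: le_trans Lam1.
Qed.

Let err_trunc : err (bstar tau_star) <= 3 * D * Theta.
Proof.
by apply: le_trans (truncation_err tau0_gt0) _; rewrite tau0_r; lra.
Qed.

(** The argument for the Lasso is repeated on [N], with penalty level [lam * rho] and the truncated
    oracle as competitor. *)
Lemma adaptive_bounds :
  err b <= X1 * Theta /\
  l1norm (b - bstar tau_star) <=
    (14 * (X1 + 3 * D) + 45 * D ^+ 2) * (r * Theta / kappa).
Proof.
have [bD bmin] := adaptive.
have tau0_ge : D * theta <= tau_star * r by rewrite tau0_r.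
have [N SN Nk] := ex_support_superset tau0_gt0 tau0_ge.
have rN := sqrt_card_le Nk.
set b1 := bstar tau_star; set eta := b - b1; set rho := mu / tau_star.
have rho_gt0 : 0 < rho := lt_le_trans ltr01 rho1.
pose x := err b; pose e := err b1.
have x0 : 0 <= x := enorm_ge0 _; have e0 : 0 <= e := enorm_ge0 _.
have e_le : e <= 3 * D * Theta := err_trunc.
pose yN := l1norm (restr eta N); pose z := l1norm (restr eta (~: N)).
pose y := Num.sqrt #|N|%:R * l2norm (restr eta N).
have yNy : yN <= y := l1norm_le_l2norm _ _.
have yN0 : 0 <= yN := l1norm_ge0 _; have z0 : 0 <= z := l1norm_ge0 _.
have lrho : 0 < lam * rho by rewrite mulr_gt0.
(* Since [1 <= rho], half of the effective penalty absorbs the noise. *)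
have basic : x ^+ 2 + lam * rho / 2 * z <= e ^+ 2 + 3 / 2 * (lam * rho * y).
  have b1D j : binit j 0 = 0 -> b1 j 0 = 0.
    move=> w0; rewrite mxE !finset.inE w0 normr0.
    by rewrite (ltNge tau_star) (ltW tau0_gt0) andbF.
  have pen := adaptive_penalty_le tau0_gt0 SN bD;
  rewrite -/b1 -/eta -/yN -/z in pen.
  have mu0 : 0 < mu.
    apply: lt_le_trans mu_ge; rewrite mulr_gt0 ?divr_gt0 ?exprn_gt0 ?mulr_gt0 //.
    by have := D1; lra.
  have hl : loss X (f0 + eps) b
      <= loss X (f0 + eps) b1 + lam * mu * ((yN - z) / tau_star).
    have := bmin b1 b1D; have := ler_wpM2l (ltW (mulr_gt0 lam0 mu0)) pen; lra.
  have := basic_inequality noise hl.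
  rewrite -/eta (l1norm_split eta N) -/x -/e -/yN -/z.
  have -> : lam * mu * ((yN - z) / tau_star) = lam * rho * (yN - z).
    by rewrite /rho; field; rewrite !gt_eqF //; have := D1; lra.
  have h1 : lam * 1 <= lam * rho by rewrite ler_wpM2l // ltW.
  have h2 := ler_wpM2l (ltW lrho) yNy.
  have h3 := ler_wpM2r yN0 h1; have h4 := ler_wpM2r z0 h1; lra.
have kr0 : 0 < r / kappa by rewrite divr_gt0.
have rk0 : 0 <= r * Theta / kappa.
  by rewrite mulrAC mulr_ge0 // ltW.
(* The first case again yields the cone constant 6; in the second, [e ^+ 2] dominates. *)
have [c|c] := leP (e ^+ 2) (3 / 2 * (lam * rho * y)).
  have z6 : z <= 6 * y.
    by rewrite -(ler_pM2l lrho); have := sqr_ge0 x; lra.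
  have y_le : y <= 2 * (r / kappa) * (x + e).
    have S0N := fintype.subset_trans (finset.subsetUl _ _) SN.
    have := @phi_le_restricted R n p X 6 S0 N eta _ S0N; rewrite -mulrA -/z -/y Nk.
    move/(_ (ler0n _ _) z6); rewrite mulrC -ler_pdivlMr // => h.
    have h' : l2norm (restr eta N) <= (x + e) / kappa.
      apply: le_trans h _; rewrite ler_pM2r ?invr_gt0 //.
      exact: enorm_mulmxB_le.
    have -> : 2 * (r / kappa) * (x + e) = 2 * r * ((x + e) / kappa) by ring.
    by apply: ler_pM; rewrite ?sqrtr_ge0 ?l2norm_ge0.
  pose g := 3 * (lam * rho * (r / kappa)).
  have g0 : 0 <= g by rewrite mulr_ge0 // mulr_ge0 // ltW.
  have g_le : g <= 3 * K * Theta.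
    have -> : 3 * K * Theta = 3 * (lam * (K * (Lam / kappa)) * (r / kappa)).
      by field; rewrite gt_eqF.
    by rewrite ler_pM2l // ler_pM2r // ler_pM2l.
  have x_le : x <= e + g.
    apply: quadratic_le => //.
    have := ler_wpM2l (ltW lrho) y_le.
    have : 0 <= lam * rho / 2 * z by rewrite mulr_ge0 // divr_ge0 // ltW.
    rewrite /g; lra.
  have xX : x <= X1 * Theta.
    apply: le_trans x_le _; apply: le_trans (lerD e_le g_le) _.
    by have := mulr_ge0 (le_trans ler01 D1) Theta_ge0; lra.
  split=> //; rewrite (l1norm_split eta N) -/yN -/z.
  apply: (@le_trans _ _ (7 * y)); first by lra.
  apply: (@le_trans _ _ (14 * (X1 + 3 * D) * (r * Theta / kappa))); last first.
    by rewrite ler_wpM2r // lerDl mulr_ge0 // sqr_ge0.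
  have : 2 * (r / kappa) * (x + e) <= 2 * (r / kappa) * ((X1 + 3 * D) * Theta).
    have kr2 : 0 <= 2 * (r / kappa) by rewrite mulr_ge0 // ltW.
    by rewrite (ler_wpM2l kr2) // [leRHS]mulrDl lerD.
  lra.
have e2 : e ^+ 2 <= (3 * D * Theta) ^+ 2.
  by rewrite ler_sqr ?nnegrE // (le_trans e0).
split.
  have : x <= 2 * e.
    have e20 : 0 <= 2 * e by rewrite mulr_ge0.
    rewrite -ler_sqr ?nnegrE //.
    have : 0 <= lam * rho / 2 * z by rewrite mulr_ge0 // divr_ge0 // ltW.
    by have := sqr_ge0 e; lra.
  by rewrite -/x; have := mulr_ge0 (ltW K0) Theta_ge0; lra.
rewrite (l1norm_split eta N) -/yN -/z.
apply: (@le_trans _ _ (45 * D ^+ 2 * (r * Theta / kappa))); last first.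
  rewrite ler_wpM2r // lerDr mulr_ge0 //.
  by have := A0; have := K0; lra.
(* The lower bound on [rho] converts a bound on the penalty into one on the l1 norm; 45 is
   [5 * 3 ^+ 2]. *)
have lk0 : 0 < lam * (Lam / kappa) by rewrite mulr_gt0 // divr_gt0.
rewrite -(ler_pM2l lk0); apply: (@le_trans _ _ (lam * rho * (yN + z))).
  by rewrite ler_wpM2r ?addr_ge0 // ler_wpM2l // ltW.
have -> : lam * (Lam / kappa) * (45 * D ^+ 2 * (r * Theta / kappa))
          = 5 * (3 * D * Theta) ^+ 2.
  by field; rewrite gt_eqF.
by have h2 := ler_wpM2l (ltW lrho) yNy; have := sqr_ge0 x; have := sqr_ge0 e; lra.
Qed.

Local Notation Z1 := (14 * (X1 + 3 * D) + 45 * D ^+ 2).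

Let Z1_ge0 : 0 <= Z1.
Proof. by have := A0; have := K0; have := sqr_ge0 D; lra. Qed.

Let trunc_l2 : l2norm (bstar tau_star - b0) <= 2 * D * theta.
Proof. by apply: le_trans (truncation_l2 tau0_gt0) _; rewrite tau0_r; lra. Qed.

Let theta_le : theta <= Theta.
Proof. by rewrite ler_pMl. Qed.

Lemma adaptive_l1 : l1norm (b - b0) <= (Z1 + 2 * D) * (r * Theta / kappa).
Proof.
have [_ h1] := adaptive_bounds.
have -> : b - b0 = (b - bstar tau_star) + (bstar tau_star - b0) by rewrite addrA subrK.
apply: le_trans (l1normD _ _) _; rewrite [leRHS]mulrDl; apply: lerD => //.
have bS : restr (bstar tau_star - b0) S0 = bstar tau_star - b0.
  by rewrite restrD restrN b0S restrK ?finset.subsetIl.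
apply: le_trans (l1norm_supported_le bS) _.
have -> : 2 * D * (r * Theta / kappa) = r * (2 * D * (Theta / kappa)) by ring.
rewrite ler_pM2l //; apply: le_trans trunc_l2 _.
rewrite ler_wpM2l //; first by have := D1; lra.
by apply: le_trans theta_le _; rewrite ler_pdivlMr // ler_piMr.
Qed.

(** Here [l2norm_le_cone] adjoins [s] further coordinates to a set of size [2 * s], which is how
    [3 * s] arises. *)
Lemma adaptive_l2 :
  (3 * s <= p)%N -> 0 < phi X 6 S0 (3 * s) ->
  l2norm (b - b0) <= (X1 + 5 * D + 2 * Z1) * (Theta / phi X 6 S0 (3 * s)).
Proof.
set k3 := phi X 6 S0 (3 * s) => s3 k30.
have [h0 h1] := adaptive_bounds.
have tau0_ge : D * theta <= tau_star * r by rewrite tau0_r.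
have [N SN Nk] := ex_support_superset tau0_gt0 tau0_ge.
have S0N := fintype.subset_trans (finset.subsetUl _ _) SN.
have N3 : (#|N| + s = 3 * s)%N by rewrite Nk -mulSnr.
have k3k : k3 <= kappa.
  by apply: phi_mono; rewrite ?S0gt0 ?leq_pmull // leq_mul2r orbT.
have T3 : Theta / kappa <= Theta / k3 by rewrite ler_wpM2l // lef_pV2.
have -> : b - b0 = (b - bstar tau_star) + (bstar tau_star - b0) by rewrite addrA subrK.
apply: le_trans (l2normD _ _) _.
set eta := b - bstar tau_star in h1 *.
have := @l2norm_le_cone R n p X 6 S0 N eta s; rewrite N3 -/k3.
move/(_ _ S0gt0 S0N s3 k30) => h; have {h} := h _.
rewrite ler1n => /(_ isT) h2.
have h3 : enorm (X *m eta) / k3 <= (X1 + 3 * D) * (Theta / k3).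
  rewrite mulrA ler_pM2r ?invr_gt0 //; apply: le_trans (enorm_mulmxB_le _ _) _.
  by rewrite [leRHS]mulrDl lerD.
have h4 : l1norm eta / r <= Z1 * (Theta / k3).
  rewrite ler_pdivrMr //; apply: le_trans h1 _.
  have -> : Z1 * (r * Theta / kappa) = Z1 * (Theta / kappa) * r by ring.
  by rewrite ler_pM2r // ler_wpM2l.
have h5 : 2 * D * theta <= 2 * D * (Theta / k3).
  rewrite ler_wpM2l //; first by have := D1; lra.
  apply: le_trans theta_le _; rewrite ler_pdivlMr // ler_piMr //.
  exact: le_trans k3k kappa1.
have := trunc_l2; lra.
Qed.

(** At most [s] false positives exceed [tau_star]. The others form [B], counted by testing
    stationarity against a vector on [s] of them. *)
Lemma adaptive_selection :
  #|active_set b :\: S0|%:R <= (2 + 16 * X1 ^+ 2) * (Lam ^+ 2 / kappa ^+ 2 * s%:R).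
Proof.
have tau0_ge : D * theta <= tau_star * r by rewrite tau0_r.
have [hx _] := adaptive_bounds.
set H := active_set b :\: S0.
pose B := [set j in H | `|binit j 0| <= tau_star]%SET.
have tau_mu : tau_star <= mu.
  by have := rho1; rewrite ler_pdivlMr ?mul1r.
have mu0 : 0 < mu := lt_le_trans tau0_gt0 tau_mu.
have lm0 : 0 < lam * mu by rewrite mulr_gt0.
pose x := err b; have x0 : 0 <= x := enorm_ge0 _.
have s0 : 0 < s%:R :> R by rewrite ltr0n.
have HB : (#|H| <= s + #|B|)%N.
  apply: leq_trans (leq_add (card_thres_setD tau0_gt0 tau0_ge) (leqnn _)).
  apply: leq_trans (leq_card_setU _ _); rewrite subset_leq_card //.
  apply/fintype.subsetP => j jH; rewrite !finset.inE; move: (jH).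
  rewrite !finset.inE => /andP[-> ->] /=.
  by case: leP; rewrite ?orbT.
pose Q := Lam ^+ 2 / kappa ^+ 2 * s%:R.
have sQ : s%:R <= Q.
  rewrite ler_pMl // ler_pdivlMr ?exprn_gt0 // mul1r.
  by apply: (@le_trans _ _ 1); rewrite ?exprn_ege1 // exprn_ile1 // ltW.
have Q0 : 0 <= Q by apply: le_trans sQ.
rewrite -/Q; suff : #|B|%:R <= (1 + 16 * X1 ^+ 2) * Q.
  have : #|H|%:R <= s%:R + #|B|%:R :> R by rewrite -natrD ler_nat.
  lra.
have [sB|Bs] := leqP s #|B|; last first.
  apply: (@le_trans _ _ s%:R); first by rewrite ler_nat ltnW.
  have := mulr_ge0 (sqr_ge0 X1) Q0; lra.
(* Taking the smallest entries gains a factor [s / #|B|] on the sum of squares; this factor later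
   bounds [#|B|]. *)
have [B' [B'B B'k B'sum]] :=
  @ex_bottom_subset R _ (fun j => (binit j 0) ^+ 2) B s sB.
(* Multiplying the stationarity condition by [|binit j 0|] makes its penalty term the constant
   [lam * mu]. *)
pose w : 'cV[R]_p := \col_j
  (if j \in B' then - (Num.sg (b j 0) * `|binit j 0|) else 0).
have wB' : restr w B' = w.
  by apply/colP => j; rewrite !mxE; case: (j \in B').
have inB' j : j \in B' -> [/\ b j 0 != 0, j \notin S0 & `|binit j 0| <= tau_star].
  move/(fintype.subsetP B'B).
  by rewrite !finset.inE => /andP[/andP[-> ->] ->].
have w2 : l2norm w ^+ 2 = \sum_(j in B') binit j 0 ^+ 2.
  rewrite -wB' l2norm_restrE; apply: eq_bigr => j jB; rewrite mxE jB sqrrN exprMn.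
  have [bj _ _] := inB' j jB.
  by rewrite sqr_sg bj mul1r real_normK ?num_real.
have w_le : #|B|%:R * l2norm w ^+ 2 <= s%:R * (D * theta) ^+ 2.
  rewrite w2; apply: le_trans B'sum _; rewrite ler_wpM2l //.
  apply: (@le_trans _ _ (l2norm (binit - b0) ^+ 2)).
    apply: le_trans (sum_sqr_le_l2norm _ B); apply: ler_sum => j.
    rewrite !finset.inE => /andP[/andP[jS _] _].
    by rewrite !mxE -b0S mxE (negbTE jS) subr0.
  rewrite ler_sqr ?nnegrE ?l2norm_ge0 ?lasso_l2_error //.
  by rewrite mulr_ge0 ?(ltW theta0) // (le_trans ler01 D1).
(* On [B'] the weighted penalty level is at least [lam], so the noise consumes at most half of
   it. *)
have per j : j \in B' ->
    lam * mu / 2 <= 2 * (w j 0 * dot (X *m b - f0) (col j X) / n%:R).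
  move=> jB; have [bj jS jt] := inB' j jB.
  have binit0 : 0 < `|binit j 0|.
    rewrite normr_gt0; have [bD _] := adaptive.
    by apply: contra_neq bj => /bD.
  have kkt := adaptive_lasso_kkt adaptive bj.
  have sgn : `|Num.sg (b j 0)| = 1 by rewrite normr_sg bj.
  have := noise_dot noise (Num.sg (b j 0) *: delta_mx j 0).
  have -> : l1norm (Num.sg (b j 0) *: delta_mx j 0 : 'cV[R]_p) = 1.
    rewrite /l1norm (bigD1 j) //= big1 => [|i /negbTE ij].
      by rewrite !mxE !eqxx mulr1 sgn addr0.
    by rewrite !mxE ij mulr0 normr0.
  rewrite -scalemxAr -colE dotZr mulr1 => hn.
  have hw : lam <= lam * mu / `|binit j 0|.
    rewrite ler_pdivlMr // ler_pM2l //; exact: le_trans tau_mu.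
  have hd : dot (f0 + eps - X *m b) (col j X) =
            dot eps (col j X) - dot (X *m b - f0) (col j X).
    rewrite (_ : f0 + eps - X *m b = eps + - (X *m b - f0)); last first.
      by rewrite opprB [f0 + eps]addrC addrA.
    by rewrite dotC dotDr dotNr !(dotC (col j X)).
  rewrite hd in kkt.
  set dn := dot (X *m b - f0) (col j X) / n%:R.
  have h : lam * mu / 2 / `|binit j 0| <= - (2 * Num.sg (b j 0) * dn).
    by rewrite /dn; lra.
  rewrite [w j 0]mxE jB; move: h; rewrite ler_pdivrMr // /dn; lra.
have sum_per : s%:R * (lam * mu / 2) <= 2 * (x * (Lam * l2norm w)).
  apply: (@le_trans _ _ (2 * (dot (X *m b - f0) (X *m w) / n%:R))).
    rewrite dot_mulmx mulr_suml mulr_sumr (bigID (mem B')) /= [X in _ + X]big1; last first.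
      by move=> j /negbTE jB; rewrite mxE jB !mul0r mulr0.
    rewrite addr0 -B'k mulr_natl -sumr_const; apply: ler_sum => j jB.
    exact: per.
  rewrite ler_pM2l //; apply: le_trans (dot_le_enorm _ _) _.
  by rewrite ler_wpM2l // -[in Lam]B'k; exact: enorm_le_Lambda_sparse.
have x_le : x <= X1 * Theta := hx.
have W0 : 0 <= l2norm w := l2norm_ge0 _.
have main : s%:R * (lam * mu) <= 4 * (X1 * Theta) * Lam * l2norm w.
  have := ler_wpM2r (mulr_ge0 (ltW Lam_gt0) W0) x_le; lra.
have D0 : 0 < D := lt_le_trans ltr01 D1.
have mu' : s%:R * (lam * (D * (Lam * lam / kappa ^+ 3)))
    <= 4 * (X1 * Theta) * Lam * l2norm w.
  by apply: le_trans main; rewrite !ler_pM2l.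
have main2 : s%:R * (lam ^+ 2 * D) <= 4 * X1 * Lam * theta * kappa ^+ 3 * l2norm w.
  rewrite -(ler_pM2r (_ : 0 < Lam / kappa ^+ 3)) ?divr_gt0 ?exprn_gt0 //.
  rewrite (_ : s%:R * (lam ^+ 2 * D) * _
    = s%:R * (lam * (D * (Lam * lam / kappa ^+ 3)))); last by ring.
  apply: le_trans mu' _; rewrite le_eqVlt; apply/predU1P; left; field.
  by rewrite gt_eqF.
have c0 : 0 < s%:R * (lam ^+ 2 * D) :> R.
  by rewrite mulr_gt0 // mulr_gt0 // exprn_gt0.
(* After squaring, [w_le] replaces [#|B|] times the squared norm of [w] by a quantity free of
   [B]. *)
have main3 : #|B|%:R * (s%:R * (lam ^+ 2 * D)) ^+ 2
    <= (4 * X1 * Lam * theta * kappa ^+ 3) ^+ 2 * (s%:R * (D * theta) ^+ 2).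
  apply: (@le_trans _ _
      (#|B|%:R * (4 * X1 * Lam * theta * kappa ^+ 3 * l2norm w) ^+ 2)).
    rewrite ler_wpM2l // ler_sqr ?nnegrE ?(ltW c0) //.
    exact: le_trans (ltW c0) main2.
  by rewrite exprMn mulrCA ler_wpM2l ?sqr_ge0.
have B_le : #|B|%:R <= 16 * X1 ^+ 2 * Q.
  rewrite -(ler_pM2r (exprn_gt0 2 c0)); apply: le_trans main3 _.
  rewrite le_eqVlt; apply/predU1P; left; rewrite /Q.
  have -> : (4 * X1 * Lam * theta * kappa ^+ 3) ^+ 2 * (s%:R * (D * theta) ^+ 2)
     = 16 * X1 ^+ 2 * Lam ^+ 2 * D ^+ 2 * s%:R * lam ^+ 4
       * (r ^+ 2) ^+ 2 / kappa ^+ 2.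
    by field; rewrite gt_eqF.
  by rewrite r2; ring.
lra.
Qed.

End Adaptive.

End ErrorBounds.

(** * Choice of constants and assembly of the bounds *)

Theorem corollary3p1 (R : realType) (A : R) (hA : 0 < A) :
  exists2 c : R, 0 < c &
  forall K : R, 0 < K ->
  exists2 C : R, 0 < C &
  forall (n p : nat) (X : 'M[R]_(n, p)) (beta_true : 'cV[R]_p) (eps : 'cV[R]_n)
         (lam_init : R) (b : {set 'I_p} -> 'cV[R]_p) (S0 : {set 'I_p})
         (beta_init : 'cV[R]_p),
  let f0 := X *m beta_true in
  let Y := f0 + eps in
  let b0 := b S0 in
  let s0 := #|S0| in
  (n <= p)%N ->
  (forall j, gram X j j = 1) ->
  0 < lam_init ->
  (forall S, least_squares X f0 S (b S)) ->
  is_oracle X f0 b lam_init (active_set beta_true) S0 ->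
  (1 <= s0)%N -> (2 * s0 <= p)%N ->
  0 < phi_card X 6 S0 ->
  is_lasso X Y lam_init beta_init ->
  l2norm (X *m b S0 - f0) ^+ 2 / n%:R
    <= A * (lam_init ^+ 2 * s0%:R / phi_card X 6 S0 ^+ 2) ->
  noise_event X lam_init eps ->
  (forall (lam_thres : R) (b_thres : 'cV[R]_p),
     let S_thres := thres_set beta_init lam_thres in
     0 < lam_thres ->
     is_thres X Y S_thres b_thres ->
     0 < phi X 6 S0 (2 * s0) ->
     0 < phi_sparse X S0 (2 * s0) ->
     lam_init / phi X 6 S0 (2 * s0) ^+ 2 <= c * lam_thres ->
     lam_thres <= K * (lam_init / phi X 6 S0 (2 * s0) ^+ 2) ->
     [/\ l2norm (X *m b_thres - f0) ^+ 2 / n%:R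
           <= C * (Lambda_sparse X s0 ^+ 2 / phi X 6 S0 (2 * s0) ^+ 4)
                * lam_init ^+ 2 * s0%:R,
         l1norm (b_thres - b0)
           <= C * (Lambda_sparse X s0
                   / (phi_sparse X S0 (2 * s0) * phi X 6 S0 (2 * s0) ^+ 2))
                * lam_init * s0%:R,
         l2norm (b_thres - b0)
           <= C * (Lambda_sparse X s0
                   / (phi_sparse X S0 (2 * s0) * phi X 6 S0 (2 * s0) ^+ 2))
                * lam_init * Num.sqrt s0%:R
       & #|S_thres :\: S0|%:R <= C * s0%:R])
  /\
  (forall (lam_adap : R) (b_adap : 'cV[R]_p),
     let S_adap := active_set b_adap in
     0 < lam_adap ->
     is_adaptive_lasso X Y beta_init lam_init lam_adap b_adap ->
     0 < phi_min X 6 S0 (2 * s0) ->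
     0 < phi X 6 S0 (2 * s0) ->
     Lambda_sparse X s0 / phi_min X 6 S0 (2 * s0) ^+ 3 * lam_init
       <= c * lam_adap ->
     lam_adap
       <= K * (Lambda_sparse X s0 / phi_min X 6 S0 (2 * s0) ^+ 3 * lam_init) ->
     [/\ l2norm (X *m b_adap - f0) ^+ 2 / n%:R
           <= C * (Lambda_sparse X s0 ^+ 2 / phi_min X 6 S0 (2 * s0) ^+ 4)
                * lam_init ^+ 2 * s0%:R,
         l1norm (b_adap - b0)
           <= C * (Lambda_sparse X s0 / phi_min X 6 S0 (2 * s0) ^+ 3)
                * lam_init * s0%:R,
         (3 * s0 <= p)%N -> 0 < phi_min X 6 S0 (3 * s0) ->
         l2norm (b_adap - b0)
           <= C * (Lambda_sparse X s0
                   / (phi_min X 6 S0 (3 * s0) ^+ 2 * phi_min X 6 S0 (2 * s0)))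
                * lam_init * Num.sqrt s0%:R
       & #|S_adap :\: S0|%:R
           <= C * (Lambda_sparse X s0 ^+ 2 * phi_min X 6 S0 (2 * s0) ^+ 2
                   / phi X 6 S0 (2 * s0) ^+ 4) * s0%:R]).
Proof.
have D0 : 0 < 18 * (1 + A) by have := hA; lra.
set D := 18 * (1 + A) in D0.
(* With this [c] the lower bounds on the tuning parameters carry exactly the factor [D], which
   depends on [A] alone. *)
exists D^-1; first by rewrite invr_gt0.
move=> K hK.
pose X1 := 6 * D + 3 * K; pose Z1 := 14 * (X1 + 3 * D) + 45 * D ^+ 2.
pose C1 := 2 * D + K + 1; pose C2 := 3 * D + K + 1.
have X10 : 0 < X1 by rewrite /X1; lra.
have Z10 : 0 < Z1 by have := sqr_ge0 D; rewrite /Z1; lra.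
have C20 : 0 < C2 by rewrite /C2; lra.
(* The sum dominates the constants of all eight bounds. *)
pose C := C1 ^+ 2 + 2 * C2 + (Z1 + 2 * D) + (X1 + 5 * D + 2 * Z1)
          + (2 + 16 * X1 ^+ 2).
exists C; first by rewrite /C; have := sqr_ge0 C1; have := sqr_ge0 X1; lra.
have [CC1 CC2 CX1 CZ1 CX5] : [/\ C1 ^+ 2 <= C, 2 * C2 <= C, X1 ^+ 2 <= C,
    Z1 + 2 * D <= C & X1 + 5 * D + 2 * Z1 <= C].
  by rewrite /C; have := sqr_ge0 C1; have := sqr_ge0 X1; split; lra.
have [C1' CS] : 1 <= C /\ 2 + 16 * X1 ^+ 2 <= C.
  by rewrite /C; have := sqr_ge0 C1; have := sqr_ge0 X1; split; lra.
move=> n p X beta_true eps lam b S0 binit f0 Y b0 s0 np gram1 lam0 ls _ s0gt0 s2p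
  phi0 lasso bias noise.
have b0S : restr b0 S0 = b0 by have [] := ls S0.
have kphi : phi X 6 S0 (2 * s0) <= phi_card X 6 S0.
  by apply: phi_mono; rewrite // ?leq_pmull // leqnn andbT.
have r2 : Num.sqrt (s0%:R : R) ^+ 2 = s0%:R by rewrite sqr_sqrtr.
have r0 : 0 < Num.sqrt (s0%:R : R) by rewrite sqrtr_gt0 ltr0n.
set r := Num.sqrt s0%:R in r2 r0.
have Lam1 : 1 <= Lambda_sparse X s0 by exact: Lambda_sparse_ge1.
set kappa := phi X 6 S0 (2 * s0) in kphi.
set Lam := Lambda_sparse X s0 in Lam1.
have Lam0 : 0 < Lam := lt_le_trans ltr01 Lam1.
(* The bias assumption involves [phi_card X 6 S0], which is at least [kappa]. *)
have err_b0 : 0 < kappa ->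
    enorm (X *m b0 - f0) ^+ 2 <= A * (lam * r / kappa) ^+ 2.
  move=> k0; rewrite enorm_sqr; apply: le_trans bias _.
  rewrite ler_pM2l // expr_div_n exprMn r2 ler_wpM2l //.
    by rewrite mulr_ge0 ?sqr_ge0.
  by rewrite lef_pV2 ?posrE ?exprn_gt0 // ler_sqr ?nnegrE // ltW.
pose theta := lam * r / kappa ^+ 2.
split=> [tau bt S_thres tau0 thres k0 ps0 tau_ge tau_le|].
  have tau_ge' : D * (lam * r / kappa ^+ 2) <= tau * r.
    rewrite (_ : D * _ = D * (lam / kappa ^+ 2) * r); last by ring.
    rewrite ler_pM2r //; by move: tau_ge; rewrite ler_pdivlMl.
  have tau_le' : tau * r <= K * (lam * r / kappa ^+ 2).
    rewrite (_ : K * _ = K * (lam / kappa ^+ 2) * r); last by ring.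
    by rewrite ler_pM2r.
  set ps := phi_sparse X S0 (2 * s0) in ps0 *.
  have [h1 h2 h3] : [/\ enorm (X *m bt - f0) <= C1 * (Lam * theta),
      ps * l2norm (bt - b0) <= C2 * (Lam * theta)
    & l1norm (bt - b0) <= 2 * r * l2norm (bt - b0)]
    := thres_bounds gram1 lam0 hA noise s0gt0 s2p b0S lasso k0
                       (err_b0 k0) hK tau0 thres tau_ge' tau_le'.
  have h4 := card_thres_setD lam0 hA noise s0gt0 s2p b0S lasso k0
               (err_b0 k0) tau0 tau_ge'.
  have theta0 : 0 < theta by rewrite divr_gt0 ?exprn_gt0 // mulr_gt0.
  have Theta0 : 0 < Lam * theta by rewrite mulr_gt0.
  have l2b : l2norm (bt - b0) <= C2 * (Lam * theta / ps).
    by rewrite mulrA ler_pdivlMr // mulrC.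
  have Tp : 0 < Lam * theta / ps by rewrite divr_gt0.
  split.
  - rewrite -enorm_sqr.
    have -> : C * (Lam ^+ 2 / kappa ^+ 4) * lam ^+ 2 * s0%:R = C * (Lam * theta) ^+ 2.
      by rewrite -r2 /theta; field; rewrite gt_eqF.
    apply: le_trans (_ : _ <= C1 ^+ 2 * (Lam * theta) ^+ 2) _; last first.
      by rewrite ler_wpM2r ?sqr_ge0.
    rewrite -exprMn ler_sqr ?nnegrE ?enorm_ge0 //.
    exact: le_trans (enorm_ge0 _) h1.
  - have -> : C * (Lam / (ps * kappa ^+ 2)) * lam * s0%:R
              = C * (r * (Lam * theta / ps)).
      by rewrite -r2 /theta; field; rewrite !gt_eqF.
    apply: le_trans h3 _; apply: (@le_trans _ _ (2 * C2 * (r * (Lam * theta / ps)))).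
      rewrite (_ : 2 * C2 * _ = 2 * r * (C2 * (Lam * theta / ps))); last by ring.
      by rewrite ler_wpM2l // mulr_ge0 // ltW.
    by rewrite ler_wpM2r // mulr_ge0 // ltW.
  - have -> : C * (Lam / (ps * kappa ^+ 2)) * lam * r = C * (Lam * theta / ps).
      by rewrite /theta; field; rewrite !gt_eqF.
    apply: le_trans l2b _; rewrite ler_wpM2r //; first exact: ltW.
    lra.
  - apply: le_trans (_ : _ <= s0%:R) _; first by rewrite ler_nat.
    by rewrite ler_peMl.
move=> mu bt S_adap mu0 adap _ k0.
rewrite phi_minE ?(leq_pmull _ _) // => mu_ge mu_le.
have mu_ge' : D * (Lam * lam / kappa ^+ 3) <= mu.
  by move: mu_ge; rewrite ler_pdivlMl // [Lam / _ * lam]mulrAC.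
have mu_le' : mu <= K * (Lam * lam / kappa ^+ 3).
  by move: mu_le; rewrite [Lam / _ * lam]mulrAC.
have eb0 := err_b0 k0.
have [h1 _] : enorm (X *m bt - f0) <= X1 * (Lam * theta) /\ _
  := adaptive_bounds gram1 lam0 hA noise s0gt0 s2p b0S lasso k0 eb0
                 hK mu_ge' mu_le' adap.
have h2 : l1norm (bt - b0) <= (Z1 + 2 * D) * (r * (Lam * theta) / kappa)
  := adaptive_l1 gram1 lam0 hA noise s0gt0 s2p b0S lasso k0 eb0
             hK mu_ge' mu_le' adap.
have h3 : (3 * s0 <= p)%N -> 0 < phi X 6 S0 (3 * s0) ->
    l2norm (bt - b0)
      <= (X1 + 5 * D + 2 * Z1) * (Lam * theta / phi X 6 S0 (3 * s0))
  := adaptive_l2 gram1 lam0 hA noise s0gt0 s2p b0S lasso k0 eb0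
             hK mu_ge' mu_le' adap.
have h4 : #|S_adap :\: S0|%:R
    <= (2 + 16 * X1 ^+ 2) * (Lam ^+ 2 / kappa ^+ 2 * s0%:R)
  := adaptive_selection gram1 lam0 hA noise s0gt0 s2p b0S lasso k0 eb0
             hK mu_ge' mu_le' adap.
have theta0 : 0 < theta by rewrite divr_gt0 ?exprn_gt0 // mulr_gt0.
have Theta0 : 0 < Lam * theta by rewrite mulr_gt0.
split.
- rewrite -enorm_sqr.
  have -> : C * (Lam ^+ 2 / kappa ^+ 4) * lam ^+ 2 * s0%:R = C * (Lam * theta) ^+ 2.
    by rewrite -r2 /theta; field; rewrite gt_eqF.
  apply: le_trans (_ : _ <= X1 ^+ 2 * (Lam * theta) ^+ 2) _; last first.
    by rewrite ler_wpM2r ?sqr_ge0.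
  rewrite -exprMn ler_sqr ?nnegrE ?enorm_ge0 //.
  exact: le_trans (enorm_ge0 _) h1.
- have -> : C * (Lam / kappa ^+ 3) * lam * s0%:R = C * (r * (Lam * theta) / kappa).
    by rewrite -r2 /theta; field; rewrite gt_eqF.
  apply: le_trans h2 _; rewrite ler_wpM2r //.
  by rewrite divr_ge0 ?(ltW k0) // mulr_ge0 // ltW.
- move=> s3p; rewrite phi_minE ?(leq_pmull _ _) //.
  set k3 := phi X 6 S0 (3 * s0) in h3 * => k30.
  have k3k : k3 <= kappa.
    by apply: phi_mono; rewrite ?s0gt0 ?leq_pmull // leq_mul2r orbT.
  apply: le_trans (h3 s3p k30) _.
  (* [adaptive_l2] is sharper than required by the factor [kappa / k3], which is at least 1. *)
  have -> : C * (Lam / (k3 ^+ 2 * kappa)) * lam * r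
            = C * (Lam * theta / k3 * (kappa / k3)).
    by rewrite /theta; field; rewrite !gt_eqF.
  have T3 : 0 <= Lam * theta / k3 by rewrite divr_ge0 // ltW.
  apply: ler_pM => //; first lra.
  by rewrite ler_peMr // ler_pdivlMr // mul1r.
apply: le_trans h4 _.
(* As [phi_min] has been identified with [kappa], the ratio of powers reduces to [kappa ^- 2]. *)
have -> : C * (Lam ^+ 2 * kappa ^+ 2 / kappa ^+ 4) * s0%:R
          = C * (Lam ^+ 2 / kappa ^+ 2 * s0%:R).
  by field; rewrite gt_eqF.
by rewrite ler_wpM2r // mulr_ge0 // divr_ge0 ?sqr_ge0.
Qed.
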